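(* Let $p\in\{0,1,2,\ldots,\infty\}$ with $p\neq 1$. Let $\Phi:\mathrm{PSL}(2,\mathbb{R})\to\mathrm{Diff}^p(S^1)$ be a nontrivial group homomorphism. Then $\Phi$ is the conjugation of the standard inclusion by a $C^p$ diffeomorphism: there exists a $C^p$ diffeomorphism $h:S^1\to S^1$ such that $\Phi(g)=h\circ g\circ h^{-1}$ for all $g\in\mathrm{PSL}(2,\mathbb{R})$, where on the right-hand side $g$ is regarded as a diffeomorphism of $S^1$ via the standard inclusion.
   Context: $\mathrm{Diff}^p(S^1)$ is the group of all $C^p$ diffeomorphisms of the circle $S^1$; a $C^0$ diffeomorphism means a homeomorphism. The standard inclusion $\mathrm{PSL}(2,\mathbb{R})\subset\mathrm{Diff}^p(S^1)$ is the action by projective (Möbius) transformations on $S^1\cong\mathbb{R}P^1=\mathbb{R}\cup\{\infty\}$ (with a fixed standard smooth identification). Homomorphisms are abstract group homomorphisms; no continuity is assumed. The diffeomorphism $h$ may be orientation preserving or reversing. *)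

(* Defs.v *)
From HB Require Import structures.
From mathcomp Require Import all_boot all_order all_algebra.
From mathcomp Require Import ring lra.
From mathcomp Require Import generic_quotient.
From mathcomp Require Import boolp classical_sets functions reals topology.
From mathcomp Require Import normedtype derive realfun trigo.

Set Implicit Arguments.
Unset Strict Implicit.
Unset Printing Implicit Defensive.

Import Order.TTheory GRing.Theory Num.Theory.
Import numFieldNormedType.Exports.

Local Open Scope classical_set_scope.
Local Open Scope ring_scope.
Local Open Scope quotient_scope.

(* The differentiability class C^p, p in {0, 1, 2, ...} or p = oo. *)
Inductive regularity : Set := Cfin of nat | Cinf.

Section Ck.
Variable R : realType.
Implicit Types f g : R -> R.

(* The derivatives of order < k are continuous because they are derivable. *)
Definition Ck (k : nat) f : Prop :=
  (forall i, (i < k)%N -> forall x, derivable (derive1n i f) x 1) /\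
  continuous (derive1n k f).

Definition Creg (p : regularity) f : Prop :=
  match p with Cfin k => Ck k f | Cinf => forall k, Ck k f end.

Lemma derive1nSr n f : derive1n n.+1 f = derive1n n (derive1 f).
Proof. by rewrite /derive1n iterSr. Qed.

Lemma Ck0 f : Ck 0 f <-> continuous f.
Proof. by split=> [[]//|fc]; split. Qed.

Lemma CkS k f : Ck k.+1 f <-> (forall x, derivable f x 1) /\ Ck k (derive1 f).
Proof.
split=> [[fd fc]|[fd [fd' fc]]].
  split; first by move=> x; exact: (fd 0%N).
  by split=> [i ik x|]; rewrite -derive1nSr//; exact: fd.
split; last by rewrite derive1nSr.
by case=> [_|i ik] x; [exact: fd|rewrite derive1nSr; exact: fd'].
Qed.

Lemma derivable_continuous f : (forall x, derivable f x 1) -> continuous f.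
Proof.
by move=> fd x; apply/differentiable_continuous/derivable1_diffP.
Qed.

Lemma CkW k f : Ck k.+1 f -> Ck k f.
Proof.
elim: k f => [|k IH] f /CkS[fd fk].
  by apply/Ck0; exact: derivable_continuous.
by apply/CkS; split => //; exact: IH.
Qed.

Lemma Ck_cont k f : Ck k f -> continuous f.
Proof. by elim: k => [/Ck0//|k IH /CkW]. Qed.

Lemma CkS_is_derive k f f' : (forall x : R, is_derive x 1 f (f' x)) ->
  Ck k f' -> Ck k.+1 f.
Proof.
move=> ff' Hf'; apply/CkS; split; first by move=> x; apply: ex_derive.
suff -> : (derive1 f) = f' by [].
by apply/funext => x; rewrite derive1E; apply: derive_val.
Qed.

Lemma CkS_derive k f : Ck k.+1 f ->
  Ck k (derive1 f) /\ forall x : R, is_derive x 1 f ((derive1 f) x).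
Proof.
by case/CkS => fd fk; split => // x; rewrite derive1E; exact: derivableP.
Qed.

Lemma Ck_cst k c : Ck k (fun=> c).
Proof.
elim: k c => [|k IH] c; first by apply/Ck0 => x; exact: cvg_cst.
exact: (@CkS_is_derive k _ (fun=> 0)).
Qed.

Lemma Ck_id k : Ck k id.
Proof.
case: k => [|k]; first by apply/Ck0 => x; exact: cvg_id.
by apply: (@CkS_is_derive k _ (fun=> 1)); exact: Ck_cst.
Qed.

Lemma CkD k f g : Ck k f -> Ck k g -> Ck k (fun x => f x + g x).
Proof.
elim: k f g => [|k IH] f g.
  by move=> /Ck0 fc /Ck0 gc; apply/Ck0 => x; apply: cvgD; [exact: fc|exact: gc].
move=> /CkS_derive[fk fd] /CkS_derive[gk gd].
by apply: (CkS_is_derive _ (IH _ _ fk gk)) => x; exact: is_deriveD.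
Qed.

Lemma CkM k f g : Ck k f -> Ck k g -> Ck k (fun x => f x * g x).
Proof.
elim: k f g => [|k IH] f g.
  by move=> /Ck0 fc /Ck0 gc; apply/Ck0 => x; apply: cvgM; [exact: fc|exact: gc].
move=> fk gk; have [fk' fd] := CkS_derive fk; have [gk' gd] := CkS_derive gk.
apply: (CkS_is_derive _ (CkD (IH _ _ (CkW fk) gk') (IH _ _ (CkW gk) fk'))) => x.
Qed.

Lemma CkN k f : Ck k f -> Ck k (fun x => - f x).
Proof.
move=> fk; suff -> : (fun x => - f x) = (fun x => -1 * f x).
  by apply: CkM => //; exact: Ck_cst.
by apply/funext => x; rewrite mulN1r.
Qed.

Lemma CkB k f g : Ck k f -> Ck k g -> Ck k (fun x => f x - g x).
Proof. by move=> fk /CkN; exact: CkD. Qed.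

Lemma CkV k f : (forall x, f x != 0) -> Ck k f -> Ck k (fun x => (f x)^-1).
Proof.
move=> f0; elim: k => [|k IH].
  by move=> /Ck0 fc; apply/Ck0 => x; apply: cvgV => //; exact: fc.
move=> fk; have [fk' fd] := CkS_derive fk.
have fV := IH (CkW fk).
apply: (CkS_is_derive _ (CkN (CkM (CkM fV fV) fk'))) => x.
have := is_deriveV (f0 x) (fd x).
by rewrite scaleNr /GRing.scale/= expr2 invfM.
Qed.

Lemma Ck_trigo k : Ck k (@sin R) /\ Ck k (@cos R).
Proof.
elim: k => [|k [IHs IHc]].
  by split; apply/Ck0; [exact: continuous_sin|exact: continuous_cos].
split; first exact: (CkS_is_derive _ IHc).
exact: (CkS_is_derive _ (CkN IHs)).
Qed.


End Ck.

Section Circle.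
Variable R : realType.

Definition S1 := {z : R * R | z.1 ^+ 2 + z.2 ^+ 2 == 1}.

Definition crdx (z : S1) : R := (sval z).1.
Definition crdy (z : S1) : R := (sval z).2.

Lemma S1P (z : S1) : crdx z ^+ 2 + crdy z ^+ 2 = 1.
Proof. exact/eqP/(svalP z). Qed.

Lemma S1_inj (z w : S1) : crdx z = crdx w -> crdy z = crdy w -> z = w.
Proof.
case: z w => [[a b] zP] [[c d] wP]; rewrite /crdx /crdy /= => ac bd.
by apply: eq_exist; rewrite /= ac bd.
Qed.

Definition mkS1 (x y : R) (xy1 : x ^+ 2 + y ^+ 2 = 1) : S1 :=
  exist _ (x, y) (introT eqP xy1).

Definition circle_exp (t : R) : S1 := mkS1 (cos2Dsin2 t).

Lemma crdx_exp t : crdx (circle_exp t) = cos t. Proof. by []. Qed.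
Lemma crdy_exp t : crdy (circle_exp t) = sin t. Proof. by []. Qed.

(* The smooth structure of the circle is the one for which circle_exp is a
   covering by local diffeomorphisms and the inclusion into the plane is an
   embedding; a self-map f of the circle is C^p iff t |-> f (cos t, sin t) is
   C^p as a map from the line to the plane. *)
Definition Cmap (p : regularity) (f : S1 -> S1) : Prop :=
  Creg p (fun t => crdx (f (circle_exp t))) /\
  Creg p (fun t => crdy (f (circle_exp t))).

Lemma circle_exp_surj z : exists t, circle_exp t = z.
Proof.
have zP := S1P z.
have x1 : -1 <= crdx z <= 1 by apply/andP; split; nra.
have sE : Num.sqrt (1 - crdx z ^+ 2) = `|crdy z|.
  by rewrite -zP addrC addKr sqrtr_sqr.
have [y0|y0] := leP 0 (crdy z).
  exists (acos (crdx z)); apply: S1_inj; rewrite /crdx /crdy /=.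
    by rewrite acosK// in_itv.
  by rewrite sin_acos// sE ger0_norm.
exists (- acos (crdx z)); apply: S1_inj; rewrite /crdx /crdy /=.
  by rewrite cosN acosK// in_itv.
by rewrite sinN sin_acos// sE ltr0_norm// opprK.
Qed.

Lemma asin0 : asin 0 = 0 :> R.
Proof.
apply: sin_inj.
- rewrite in_itv/=; have : -1 <= (0:R) <= 1 by apply/andP; split; lra.
  by move=> H; rewrite asin_geNpi2// asin_lepi2.
- by rewrite in_itv/=; have := @pi_gt0 R; move=> ?; apply/andP; split; lra.
- by rewrite asinK ?sin0// in_itv/=; apply/andP; split; lra.
Qed.

Lemma local_lift (G : R -> S1) (t0 th0 : R) :
  {for t0, continuous (crdx \o G)} -> {for t0, continuous (crdy \o G)} ->
  circle_exp th0 = G t0 ->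
  exists th : R -> R, [/\ th t0 = th0,
    (\near t0, circle_exp (th t0) = G t0), {for t0, continuous th} &
    forall a' b', is_derive t0 1 (crdx \o G) a' -> is_derive t0 1 (crdy \o G) b' ->
      is_derive t0 1 th (crdx (G t0) * b' - crdy (G t0) * a')].
Proof.
move=> xc yc Gt0.
have xE : crdx (G t0) = cos th0 by rewrite -Gt0.
have yE : crdy (G t0) = sin th0 by rewrite -Gt0.
pose s t := cos th0 * crdy (G t) - sin th0 * crdx (G t).
pose w t := cos th0 * crdx (G t) + sin th0 * crdy (G t).
have st0 : s t0 = 0 by rewrite /s xE yE mulrC subrr.
have wt0 : w t0 = 1 by rewrite /w xE yE -!expr2 cos2Dsin2.
have sc : {for t0, continuous s}.
  by apply: cvgB; apply: cvgM => //; exact: cvg_cst.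
have wc : {for t0, continuous w}.
  by apply: cvgD; apply: cvgM => //; exact: cvg_cst.
have sw t : s t ^+ 2 + w t ^+ 2 = 1.
  have := S1P (G t); have := cos2Dsin2 th0; rewrite /s /w => e1 e2.
  transitivity ((cos th0 ^+ 2 + sin th0 ^+ 2) * (crdx (G t) ^+ 2 + crdy (G t) ^+ 2)).
    by ring.
  by rewrite e1 e2 mulr1.
exists (fun t => th0 + asin (s t)); split.
- by rewrite st0 asin0 addr0.
- near=> t.
  have wt : 0 < w t.
    near: t; apply: (cvgr_gt (w t0)) => //; by rewrite wt0 ltr01.
  have s1 : -1 <= s t <= 1 by have := sw t; move=> ?; apply/andP; split; nra.
  have ss : sin (asin (s t)) = s t by rewrite asinK// in_itv.
  have cs : cos (asin (s t)) = w t.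
    by rewrite cos_asin// -(sw t) addrC addKr sqrtr_sqr gtr0_norm.
  apply: S1_inj; rewrite ?crdx_exp ?crdy_exp.
    rewrite cosD ss cs /w /s.
    transitivity ((cos th0 ^+ 2 + sin th0 ^+ 2) * crdx (G t)); first by ring.
    by rewrite cos2Dsin2 mul1r.
  rewrite sinD ss cs /w /s.
  transitivity ((cos th0 ^+ 2 + sin th0 ^+ 2) * crdy (G t)); first by ring.
  by rewrite cos2Dsin2 mul1r.
- apply: cvgD; first exact: cvg_cst.
  apply: (@continuous_comp _ _ _ s asin) => //.
  by apply: continuous_asin; rewrite st0; apply/andP; split; lra.
- move=> a' b' xd yd.
  have sd : is_derive t0 1 s (cos th0 * b' - sin th0 * a').
    have H1 := is_deriveZ (cos th0) yd.
    have H2 := is_deriveZ (sin th0) xd.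
    exact: (is_deriveB H1 H2).
  have ad : is_derive (s t0) 1 asin ((Num.sqrt (1 - s t0 ^+ 2))^-1).
    by apply: is_derive1_asin; rewrite st0; apply/andP; split; lra.
  have := is_derive1_comp (f := asin) (g := s) ad sd.
  rewrite st0 expr0n/= subr0 sqrtr1 invr1 mul1r => H.
  have := is_deriveD (is_derive_cst th0 t0 1) H.
  by rewrite add0r xE yE.
Unshelve. all: by end_near. Qed.

Fact rotate_subproof (z : S1) (t : R) :
  (crdx z * cos t - crdy z * sin t) ^+ 2 +
  (crdx z * sin t + crdy z * cos t) ^+ 2 = 1.
Proof.
transitivity ((cos t ^+ 2 + sin t ^+ 2) * (crdx z ^+ 2 + crdy z ^+ 2)).
  by ring.
by rewrite cos2Dsin2 S1P mulr1.
Qed.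

Definition rotate (z : S1) (t : R) : S1 := mkS1 (rotate_subproof z t).

Lemma rotate_exp s t : rotate (circle_exp s) t = circle_exp (t + s).
Proof.
apply: S1_inj; rewrite /crdx /crdy /= ?cosD ?sinD /crdx /crdy/=; ring.
Qed.

Lemma derive1_shift (f : R -> R) s :
  derive1 (fun t => f (t + s)) 0 = derive1 f s.
Proof.
rewrite /derive1 /=; congr (lim _).
by under eq_fun do rewrite addr0 add0r.
Qed.

Lemma Ck_circle_comp k (u : S1 -> R) (G : R -> S1) :
  Ck k (u \o circle_exp) -> Ck k (crdx \o G) -> Ck k (crdy \o G) ->
  Ck k (u \o G).
Proof.
elim: k u => [|k IH] u.
  move=> /Ck0 uc /Ck0 xc /Ck0 yc; apply/Ck0 => t0.
  have [th0 th0E] := circle_exp_surj (G t0).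
  have [th [tht0 thG thc _]] := local_lift (xc t0) (yc t0) th0E.
  have H : (u \o circle_exp \o th) x @[x --> t0] --> (u \o G) t0.
    rewrite [(u \o G) t0]/= -th0E -tht0.
    by apply: (@continuous_comp _ _ _ th (u \o circle_exp)) => //; exact: uc.
  apply: cvg_trans H; apply: near_eq_cvg.
  by apply: filterS thG => t /= ->.
move=> uk xk yk.
have [uk' ud] := CkS_derive uk.
have [xk' xd] := CkS_derive xk.
have [yk' yd] := CkS_derive yk.
pose u' z := derive1 (fun t => u (rotate z t)) 0.
have u'E t : u' (circle_exp t) = derive1 (u \o circle_exp) t.
  rewrite /u' -(derive1_shift (u \o circle_exp)).
  suff -> : (fun h => u (rotate (circle_exp t) h)) =
    (fun h => (u \o circle_exp) (h + t)) by [].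
  by apply/funext => h; rewrite rotate_exp.
have u'k : Ck k (u' \o G).
  apply: IH; [|exact: CkW|exact: CkW].
  by rewrite (_ : _ \o _ = derive1 (u \o circle_exp))//; exact/funext.
pose d t := crdx (G t) * derive1 (crdy \o G) t - crdy (G t) * derive1 (crdx \o G) t.
have dk : Ck k d.
  by apply: CkB; apply: CkM => //; [exact: (CkW xk)|exact: (CkW yk)].
apply: (CkS_is_derive _ (CkM u'k dk)) => t0.
have [th0 th0E] := circle_exp_surj (G t0).
have [th [tht0 thG _ thd]] := local_lift (@Ck_cont _ _ _ xk t0) (@Ck_cont _ _ _ yk t0) th0E.
have {}thd := thd _ _ (xd t0) (yd t0).
apply: (@near_eq_is_derive _ _ _ ((u \o circle_exp) \o th)).
- by apply: filterS thG => t /= ->.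
- have := is_derive1_comp (ud (th t0)) thd.
  by rewrite -u'E tht0 th0E.
Qed.

Lemma Cmap_id p : Cmap p id.
Proof.
case: p => [k|]; rewrite /Cmap /crdx /crdy/=.
  by split; have [] := Ck_trigo R k.
by split => k; have [] := Ck_trigo R k.
Qed.

Lemma Cmap_comp p f g : Cmap p f -> Cmap p g -> Cmap p (f \o g).
Proof.
case: p => [k|] [fx fy] [gx gy]; split.
- exact: (@Ck_circle_comp k (crdx \o f) (g \o circle_exp)).
- exact: (@Ck_circle_comp k (crdy \o f) (g \o circle_exp)).
- move=> k; exact: (@Ck_circle_comp k (crdx \o f) (g \o circle_exp)).
- move=> k; exact: (@Ck_circle_comp k (crdy \o f) (g \o circle_exp)).
Qed.

End Circle.

Section Diff.
Variables (R : realType) (p : regularity).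
Local Notation S1 := (S1 R).

(* For p = 0 these are the homeomorphisms of the circle. *)
Definition is_Cdiffeo (f : S1 -> S1) : Prop :=
  exists g : S1 -> S1, [/\ cancel f g, cancel g f, Cmap p f & Cmap p g].

Record Diff := MkDiff { diff_fun :> S1 -> S1; diffP : is_Cdiffeo diff_fun }.

HB.instance Definition _ := gen_eqMixin Diff.
HB.instance Definition _ := gen_choiceMixin Diff.

Lemma diff_ext (f g : Diff) : f =1 g -> f = g.
Proof.
case: f g => [f fP] [g gP] /= /funext fg; move: fP gP; rewrite fg => fP gP.
by congr MkDiff; exact: Prop_irrelevance.
Qed.

Fact diff_one_subproof : is_Cdiffeo id.
Proof. by exists id; split => //; exact: Cmap_id. Qed.
Definition diff_one : Diff := MkDiff diff_one_subproof.

Fact diff_mul_subproof (f g : Diff) : is_Cdiffeo (f \o g).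
Proof.
case: f g => [f [f' [fK f'K fC f'C]]] [g [g' [gK g'K gC g'C]]] /=.
exists (g' \o f'); split; [exact: can_comp|exact: can_comp| |]; exact: Cmap_comp.
Qed.
Definition diff_mul (f g : Diff) : Diff := MkDiff (diff_mul_subproof f g).

Fact diff_inv_subproof (f : Diff) : is_Cdiffeo (sval (cid (diffP f))).
Proof. by case: cid => g [? ? ? ?] /=; exists f. Qed.
Definition diff_inv (f : Diff) : Diff := MkDiff (diff_inv_subproof f).

Lemma diff_invK (f : Diff) : cancel f (diff_inv f).
Proof. by rewrite /diff_inv /=; case: cid => g []. Qed.

Lemma diff_invKr (f : Diff) : cancel (diff_inv f) f.
Proof. by rewrite /diff_inv /=; case: cid => g []. Qed.

Fact diff_mulA : associative diff_mul.
Proof. by move=> f g h; exact: diff_ext. Qed.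
Fact diff_mul1 : left_id diff_one diff_mul.
Proof. by move=> f; exact: diff_ext. Qed.
Fact diff_1mul : right_id diff_one diff_mul.
Proof. by move=> f; exact: diff_ext. Qed.
Fact diff_mulV : left_inverse diff_one diff_inv diff_mul.
Proof. by move=> f; apply: diff_ext => z; exact: diff_invK. Qed.
Fact diff_Vmul : right_inverse diff_one diff_inv diff_mul.
Proof. by move=> f; apply: diff_ext => z; exact: diff_invKr. Qed.

HB.instance Definition _ :=
  isGroup.Build Diff diff_mulA diff_mul1 diff_1mul diff_mulV diff_Vmul.

Lemma DiffM (f g : Diff) z : (f * g)%g z = f (g z). Proof. by []. Qed.
Lemma Diff1 z : (1%g : Diff) z = z. Proof. by []. Qed.

End Diff.

Section PSL2.
Variable R : realType.

Record SL2 := MkSL2 { SL2_mx :> 'M[R]_2; SL2_det : \det SL2_mx == 1 }.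

HB.instance Definition _ := [isSub for SL2_mx].
HB.instance Definition _ := [Choice of SL2 by <:].

Fact SL2_one_subproof : \det (1%:M : 'M[R]_2) == 1.
Proof. by rewrite det1. Qed.
Definition SL2_one : SL2 := MkSL2 SL2_one_subproof.

Fact SL2_mul_subproof (A B : SL2) : \det (A *m B) == 1.
Proof. by rewrite det_mulmx (eqP (SL2_det A)) (eqP (SL2_det B)) mulr1. Qed.
Definition SL2_mul (A B : SL2) : SL2 := MkSL2 (SL2_mul_subproof A B).

Fact SL2_inv_subproof (A : SL2) : \det (invmx A) == 1.
Proof. by rewrite det_inv (eqP (SL2_det A)) invr1. Qed.
Definition SL2_inv (A : SL2) : SL2 := MkSL2 (SL2_inv_subproof A).

Lemma SL2_unit (A : SL2) : (A : 'M[R]_2) \in unitmx.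
Proof. by rewrite unitmxE (eqP (SL2_det A)) unitr1. Qed.

Fact SL2_mulA : associative SL2_mul.
Proof. by move=> A B C; apply: val_inj; exact: mulmxA. Qed.
Fact SL2_1mul : left_id SL2_one SL2_mul.
Proof. by move=> A; apply: val_inj; exact: mul1mx. Qed.
Fact SL2_mul1 : right_id SL2_one SL2_mul.
Proof. by move=> A; apply: val_inj; exact: mulmx1. Qed.
Fact SL2_Vmul : left_inverse SL2_one SL2_inv SL2_mul.
Proof. by move=> A; apply: val_inj; apply: mulVmx; exact: SL2_unit. Qed.
Fact SL2_mulV : right_inverse SL2_one SL2_inv SL2_mul.
Proof. by move=> A; apply: val_inj; apply: mulmxV; exact: SL2_unit. Qed.

HB.instance Definition _ :=
  isGroup.Build SL2 SL2_mulA SL2_1mul SL2_mul1 SL2_Vmul SL2_mulV.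

(* Equality in SL(2, R) modulo the center {1, -1}. *)
Definition SL2_pm (A B : SL2) : bool :=
  (A == B :> 'M[R]_2) || (A == - (B : 'M[R]_2) :> 'M[R]_2).

Fact SL2_pm_refl : reflexive SL2_pm.
Proof. by move=> A; rewrite /SL2_pm eqxx. Qed.
Fact SL2_pm_sym : symmetric SL2_pm.
Proof. by move=> A B; rewrite /SL2_pm eq_sym -eqr_oppLR [- _ == _]eq_sym. Qed.
Fact SL2_pm_trans : transitive SL2_pm.
Proof.
move=> B A C; rewrite /SL2_pm => /orP[]/eqP-> // /orP[]/eqP->.
  by rewrite eqxx orbT.
by rewrite opprK eqxx.
Qed.

Canonical SL2_pm_equiv := EquivRel SL2_pm SL2_pm_refl SL2_pm_sym SL2_pm_trans.

Definition PSL2 := {eq_quot SL2_pm_equiv}.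
HB.instance Definition _ := Choice.on PSL2.
HB.instance Definition _ := EqQuotient.on PSL2.

Definition PSL2_one : PSL2 := \pi_PSL2 1%g.
Definition PSL2_mul (a b : PSL2) : PSL2 := \pi_PSL2 (repr a * repr b)%g.
Definition PSL2_inv (a : PSL2) : PSL2 := \pi_PSL2 (repr a)^-1%g.

Lemma PSL2_eqP (A B : SL2) : reflect (\pi_PSL2 A = \pi_PSL2 B) (SL2_pm A B).
Proof. exact: eqmodP. Qed.

Lemma SL2_pm_repr (A : SL2) : SL2_pm (repr (\pi_PSL2 A)) A.
Proof. by apply/PSL2_eqP; rewrite reprK. Qed.

Lemma PSL2_piM A B : PSL2_mul (\pi_PSL2 A) (\pi_PSL2 B) = \pi_PSL2 (A * B)%g.
Proof.
apply/PSL2_eqP; have := SL2_pm_repr A; have := SL2_pm_repr B.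
rewrite /SL2_pm /= => /orP[]/eqP-> /orP[]/eqP->;
  by rewrite ?mulNmx ?mulmxN ?opprK eqxx ?orbT.
Qed.

Lemma PSL2_piV A : PSL2_inv (\pi_PSL2 A) = \pi_PSL2 (A^-1)%g.
Proof.
apply/PSL2_eqP; have := SL2_pm_repr A.
rewrite /SL2_pm /= => /orP[]/eqP->; first by rewrite eqxx.
have uA := SL2_unit A.
have NA : (-1) *: (A : 'M[R]_2) \in unitmx by rewrite unitmxZ ?unitrN1.
by rewrite -scaleN1r invmxZ// invrN1 scaleN1r eqxx orbT.
Qed.

Lemma PSL2_ind (P : PSL2 -> Prop) : (forall A, P (\pi_PSL2 A)) -> forall a, P a.
Proof. by move=> H a; rewrite -[a]reprK. Qed.

Fact PSL2_mulA : associative PSL2_mul.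
Proof.
by elim/PSL2_ind=> A; elim/PSL2_ind=> B; elim/PSL2_ind=> C;
  rewrite !PSL2_piM mulgA.
Qed.
Fact PSL2_1mul : left_id PSL2_one PSL2_mul.
Proof. by elim/PSL2_ind=> A; rewrite PSL2_piM mul1g. Qed.
Fact PSL2_mul1 : right_id PSL2_one PSL2_mul.
Proof. by elim/PSL2_ind=> A; rewrite PSL2_piM mulg1. Qed.
Fact PSL2_Vmul : left_inverse PSL2_one PSL2_inv PSL2_mul.
Proof. by elim/PSL2_ind=> A; rewrite PSL2_piV PSL2_piM mulVg. Qed.
Fact PSL2_mulV : right_inverse PSL2_one PSL2_inv PSL2_mul.
Proof. by elim/PSL2_ind=> A; rewrite PSL2_piV PSL2_piM mulgV. Qed.

HB.instance Definition _ :=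
  isGroup.Build PSL2 PSL2_mulA PSL2_1mul PSL2_mul1 PSL2_Vmul PSL2_mulV.

Lemma PSL2M (A B : SL2) : (\pi_PSL2 A * \pi_PSL2 B)%g = \pi_PSL2 (A * B)%g.
Proof. exact: PSL2_piM. Qed.

End PSL2.

Section Moebius.
Variable R : realType.
Implicit Types (A B : 'M[R]_2) (z : S1 R).

(* None is the point at infinity; [x : y] in RP^1 corresponds to x / y. *)
Definition moebius A (t : option R) : option R :=
  let a := A 0 0 in let b := A 0 1 in let c := A 1 0 in let d := A 1 1 in
  match t with
  | Some t => if c * t + d == 0 then None else Some ((a * t + b) / (c * t + d))
  | None => if c == 0 then None else Some (a / c)
  end.

(* Stereographic projection from the north pole (0, 1), which is sent to
   infinity; it is a diffeomorphism from the circle onto RP^1. *)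
Definition stereo z : option R :=
  if crdy z == 1 then None else Some (crdx z / (1 - crdy z)).

Lemma sqrD1_neq0 (t : R) : t ^+ 2 + 1 != 0.
Proof. by rewrite gt_eqF// ltr_wpDl ?sqr_ge0. Qed.

Fact stereo_inv_subproof (t : R) :
  (t *+ 2 / (t ^+ 2 + 1)) ^+ 2 + ((t ^+ 2 - 1) / (t ^+ 2 + 1)) ^+ 2 = 1.
Proof. by field; exact: sqrD1_neq0. Qed.

Fact north_subproof : 0 ^+ 2 + 1 ^+ 2 = 1 :> R.
Proof. by rewrite expr0n/= expr1n add0r. Qed.

Definition stereo_inv (t : option R) : S1 R :=
  match t with
  | Some t => mkS1 (stereo_inv_subproof t)
  | None => mkS1 north_subproof
  end.

Lemma stereoK : cancel stereo stereo_inv.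
Proof.
move=> z; rewrite /stereo; have zP := S1P z; case: ifPn => [/eqP y1|y1] /=.
  apply: S1_inj => //=.
  by move: zP; rewrite y1 expr1n => /(canRL (addrK _)); rewrite subrr => /eqP;
    rewrite sqrf_eq0 => /eqP.
have y1' : 1 - crdy z != 0 by rewrite subr_eq0 eq_sym.
have E : (crdx z / (1 - crdy z)) ^+ 2 = (1 + crdy z) / (1 - crdy z).
  have -> : (crdx z / (1 - crdy z)) ^+ 2 =
      (crdx z ^+ 2 + crdy z ^+ 2 - crdy z ^+ 2) / (1 - crdy z) ^+ 2 by field.
  by rewrite zP; field.
have E1 : (1 + crdy z) / (1 - crdy z) + 1 = 2 / (1 - crdy z) by field.
apply: S1_inj; rewrite {1}/crdx {1}/crdy /= E E1; by field.
Qed.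

Lemma stereo_invK : cancel stereo_inv stereo.
Proof.
case=> [t|]; rewrite /stereo /crdx /crdy /=; last by rewrite eqxx.
have t0 := sqrD1_neq0 t.
have E : 1 - (t ^+ 2 - 1) / (t ^+ 2 + 1) = 2 / (t ^+ 2 + 1) by field.
rewrite -subr_eq0 -oppr_eq0 opprB E mulf_eq0 invr_eq0 (negbTE t0) pnatr_eq0/=.
by congr Some; field.
Qed.

Definition circle_act A z : S1 R := stereo_inv (moebius A (stereo z)).

Definition proj (X Y : R) : option R := if Y == 0 then None else Some (X / Y).
Definition homX (t : option R) : R := odflt 1 t.
Definition homY (t : option R) : R := if t is Some _ then 1 else 0.

Lemma moebiusE A t : moebius A t =
  proj (A 0 0 * homX t + A 0 1 * homY t) (A 1 0 * homX t + A 1 1 * homY t).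
Proof. by case: t => [t|]; rewrite /moebius /proj /= ?mulr1 ?mulr0 ?addr0. Qed.

Lemma projZ k X Y : k != 0 -> proj (k * X) (k * Y) = proj X Y.
Proof.
move=> k0; rewrite /proj mulf_eq0 (negbTE k0)/=; case: ifPn => // Y0.
by congr Some; field; rewrite Y0.
Qed.

Lemma hom_proj X Y : (X != 0) || (Y != 0) -> exists2 k, k != 0 &
  homX (proj X Y) = k * X /\ homY (proj X Y) = k * Y.
Proof.
rewrite /proj; have [->|Y0] := eqVneq Y 0; rewrite ?orbT ?orbF => X0.
  by exists X^-1; rewrite ?invr_eq0//= mulVf// mulr0.
by exists Y^-1; rewrite ?invr_eq0//= mulVf// mulrC.
Qed.

Lemma hom_neq0 t : (homX t != 0) || (homY t != 0).
Proof. by case: t => [t|] /=; rewrite oner_eq0 ?orbT. Qed.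

Lemma det2E A : \det A = A 0 0 * A 1 1 - A 0 1 * A 1 0.
Proof.
rewrite (expand_det_row _ 0) !big_ord_recl big_ord0 /cofactor !det_mx11 !mxE/=.
rewrite (_ : lift 0 0 = 1)//; last exact/val_inj.
rewrite (_ : lift 1 0 = 0)//; last exact/val_inj.
by rewrite expr0 expr1 addr0; ring.
Qed.

Lemma mul2E A B i j : (A *m B) i j = A i 0 * B 0 j + A i 1 * B 1 j.
Proof.
rewrite mxE !big_ord_recl big_ord0 addr0.
by rewrite (_ : lift 0 0 = 1)//; exact/val_inj.
Qed.

Lemma mul2_neq0 A X Y : \det A != 0 -> (X != 0) || (Y != 0) ->
  (A 0 0 * X + A 0 1 * Y != 0) || (A 1 0 * X + A 1 1 * Y != 0).
Proof.
rewrite det2E => dA XY; apply: contraTT XY.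
rewrite !negb_or !negbK => /andP[/eqP e1 /eqP e2].
have eX : (A 0 0 * A 1 1 - A 0 1 * A 1 0) * X =
  A 1 1 * (A 0 0 * X + A 0 1 * Y) - A 0 1 * (A 1 0 * X + A 1 1 * Y) by ring.
have eY : (A 0 0 * A 1 1 - A 0 1 * A 1 0) * Y =
  A 0 0 * (A 1 0 * X + A 1 1 * Y) - A 1 0 * (A 0 0 * X + A 0 1 * Y) by ring.
move: eX eY; rewrite e1 e2 !mulr0 subrr => /eqP + /eqP.
by rewrite !mulf_eq0 (negbTE dA) /= => -> ->.
Qed.

Lemma moebius1 t : moebius 1%:M t = t.
Proof.
by rewrite moebiusE !mxE/= ?mul1r ?mul0r ?addr0 ?add0r /proj; case: t => [t|];
  rewrite /= ?oner_eq0 ?divr1 ?eqxx.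
Qed.

Lemma moebiusM A B t : \det B != 0 ->
  moebius (A *m B) t = moebius A (moebius B t).
Proof.
move=> dB; rewrite [moebius B t]moebiusE.
have [k k0 [kX kY]] := hom_proj (mul2_neq0 dB (hom_neq0 t)).
rewrite !moebiusE kX kY !mul2E -(projZ _ _ k0); congr proj; ring.
Qed.

Lemma moebiusN A t : moebius (- A) t = moebius A t.
Proof.
rewrite !moebiusE !mxE -[in RHS](@projZ (-1)) ?oppr_eq0 ?oner_eq0//.
by congr proj; ring.
Qed.

Lemma circle_act1 z : circle_act 1%:M z = z.
Proof. by rewrite /circle_act moebius1 stereoK. Qed.

Lemma circle_actM A B z : \det B != 0 ->
  circle_act (A *m B) z = circle_act A (circle_act B z).
Proof. by move=> dB; rewrite /circle_act stereo_invK moebiusM. Qed.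

Lemma circle_actN A z : circle_act (- A) z = circle_act A z.
Proof. by rewrite /circle_act moebiusN. Qed.

Lemma sqrD_neq0 (X Y : R) : (X != 0) || (Y != 0) -> X ^+ 2 + Y ^+ 2 != 0.
Proof. by rewrite paddr_eq0 ?sqr_ge0// !sqrf_eq0 negb_and. Qed.

Lemma stereo_inv_proj X Y : (X != 0) || (Y != 0) ->
  crdx (stereo_inv (proj X Y)) = (X * Y) *+ 2 / (X ^+ 2 + Y ^+ 2) /\
  crdy (stereo_inv (proj X Y)) = (X ^+ 2 - Y ^+ 2) / (X ^+ 2 + Y ^+ 2).
Proof.
rewrite /proj; have [->|Y0] := eqVneq Y 0; rewrite ?orbT ?orbF => X0.
  by rewrite /crdx /crdy /= mulr0 mul0rn mul0r expr0n/= subr0 addr0 divff// sqrf_eq0.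
have XY : X ^+ 2 + Y ^+ 2 != 0 by rewrite sqrD_neq0// Y0 orbT.
by rewrite /crdx /crdy/=; split; field; rewrite XY Y0.
Qed.

(* The action in terms of the entries of the rank one projection
   (1 + y, x; x, 1 - y) / 2 onto the line represented by (x, y). *)
Lemma circle_act_crd A z : \det A != 0 ->
  let q X Y X' Y' :=
    X * X' * (1 + crdy z) + (X * Y' + X' * Y) * crdx z + Y * Y' * (1 - crdy z) in
  let P := q (A 0 0) (A 0 1) (A 0 0) (A 0 1) in
  let Q := q (A 0 0) (A 0 1) (A 1 0) (A 1 1) in
  let S := q (A 1 0) (A 1 1) (A 1 0) (A 1 1) in
  [/\ P + S != 0, crdx (circle_act A z) = Q *+ 2 / (P + S) &
      crdy (circle_act A z) = (P - S) / (P + S)].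
Proof.
move=> dA q P Q S; have zP := S1P z.
pose tX := homX (stereo z); pose tY := homY (stereo z).
have [k k0 [kX kY kXY]] : exists2 k, k != 0 & [/\ 1 + crdy z = k * tX ^+ 2,
    1 - crdy z = k * tY ^+ 2 & crdx z = k * (tX * tY)].
  rewrite /tX /tY /stereo; case: ifPn => [/eqP y1|y1] /=.
    exists 2; first by rewrite pnatr_eq0.
    have x0 : crdx z = 0.
      by apply/eqP; rewrite -sqrf_eq0; apply/eqP; move: zP; rewrite y1; lra.
    by rewrite x0 y1; split; ring.
  have y1' : 1 - crdy z != 0 by rewrite subr_eq0 eq_sym.
  exists (1 - crdy z) => //; split; [|by ring|by field].
  have -> : (1 - crdy z) * (crdx z / (1 - crdy z)) ^+ 2 =
    (crdx z ^+ 2 + crdy z ^+ 2 - crdy z ^+ 2) / (1 - crdy z) by field.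
  by rewrite zP; field.
rewrite /circle_act moebiusE -/tX -/tY.
set X := A 0 0 * tX + A 0 1 * tY; set Y := A 1 0 * tX + A 1 1 * tY.
have XY : (X != 0) || (Y != 0) := mul2_neq0 dA (hom_neq0 (stereo z)).
have PE : P = k * X ^+ 2 by rewrite /P /q kX kY kXY /X; ring.
have QE : Q = k * (X * Y) by rewrite /Q /q kX kY kXY /X /Y; ring.
have SE : S = k * Y ^+ 2 by rewrite /S /q kX kY kXY /Y; ring.
have XY2 := sqrD_neq0 XY.
have [-> ->] := stereo_inv_proj XY.
rewrite PE QE SE -mulrDr; split; first by rewrite mulf_neq0.
  by field; rewrite k0 XY2.
by field; rewrite k0 XY2.
Qed.

Lemma Creg_all p (f : R -> R) : (forall k, Ck k f) -> Creg p f.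
Proof. by case: p => [n|] fk; exact: fk. Qed.

Lemma Cmap_circle_act p A : \det A != 0 -> Cmap p (circle_act A).
Proof.
move=> dA.
have qk X Y X' Y' k : Ck k (fun t : R => X * X' * (1 + sin t) +
    (X * Y' + X' * Y) * cos t + Y * Y' * (1 - sin t)).
  have [sk ck] := Ck_trigo R k.
  have c1 := Ck_cst k (1 : R).
  have H1 := CkM (Ck_cst k (X * X')) (CkD c1 sk).
  have H2 := CkM (Ck_cst k (X * Y' + X' * Y)) ck.
  have H3 := CkM (Ck_cst k (Y * Y')) (CkB c1 sk).
  exact: (CkD (CkD H1 H2) H3).
have nz t := circle_act_crd (circle_exp t) dA.
pose q X Y X' Y' (t : R) := X * X' * (1 + sin t) +
    (X * Y' + X' * Y) * cos t + Y * Y' * (1 - sin t).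
pose P := q (A 0 0) (A 0 1) (A 0 0) (A 0 1).
pose Q := q (A 0 0) (A 0 1) (A 1 0) (A 1 1).
pose S := q (A 1 0) (A 1 1) (A 1 0) (A 1 1).
have V k : Ck k (fun t => (P t + S t)^-1).
  apply: CkV => [t|]; first by have [] := nz t.
  exact: (CkD (qk _ _ _ _ k) (qk _ _ _ _ k)).
split; apply: Creg_all => k.
  rewrite (_ : (fun t => _) = fun t => (Q t + Q t) * (P t + S t)^-1).
    exact: (CkM (CkD (qk _ _ _ _ k) (qk _ _ _ _ k)) (V k)).
  by apply/funext => t; have [_ -> _] := nz t.
rewrite (_ : (fun t => _) = fun t => (P t - S t) * (P t + S t)^-1).
  exact: (CkM (CkB (qk _ _ _ _ k) (qk _ _ _ _ k)) (V k)).
by apply/funext => t; have [_ _ ->] := nz t.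
Qed.

End Moebius.

Section StandardInclusion.
Variables (R : realType) (p : regularity).

Lemma SL2_det_neq0 (A : SL2 R) : \det A != 0.
Proof. by rewrite (eqP (SL2_det A)) oner_neq0. Qed.

Fact std_incl_subproof (A : SL2 R) : is_Cdiffeo p (circle_act A).
Proof.
exists (circle_act (A^-1)%g); split.
- by move=> z; rewrite -circle_actM ?SL2_det_neq0// mulVmx ?SL2_unit// circle_act1.
- by move=> z; rewrite -circle_actM ?SL2_det_neq0// mulmxV ?SL2_unit// circle_act1.
- exact/Cmap_circle_act/SL2_det_neq0.
- exact/Cmap_circle_act/SL2_det_neq0.
Qed.

(* circle_act is insensitive to the choice of representative, see std_incl_pi. *)
Definition std_incl (g : PSL2 R) : Diff R p := MkDiff (std_incl_subproof (repr g)).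

Lemma std_incl_pi (A : SL2 R) z : std_incl (\pi_(PSL2 R) A) z = circle_act A z.
Proof.
rewrite /std_incl /=; have := SL2_pm_repr A.
by rewrite /SL2_pm => /orP[]/eqP->; rewrite ?circle_actN.
Qed.

Fact std_inclM : {morph std_incl : g h / (g * h)%g >-> (g * h)%g}.
Proof.
elim/PSL2_ind => A; elim/PSL2_ind => B; apply: diff_ext => z.
rewrite DiffM PSL2M !std_incl_pi circle_actM//; exact: SL2_det_neq0.
Qed.

HB.instance Definition _ :=
  isMultiplicative.Build (PSL2 R) (Diff R p) std_incl std_inclM.

End StandardInclusion.

(* Main.v *)
Require Import Defs.
From HB Require Import structures.
From mathcomp Require Import all_boot all_order all_algebra.
From mathcomp Require Import ring lra zify.
From mathcomp Require Import generic_quotient.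
From mathcomp Require Import boolp classical_sets functions reals topology.
From mathcomp Require Import normedtype sequences derive realfun exp trigo.

(** A unipotent element is conjugate to its square, and a positive diagonal
    element is both a square and conjugate to its inverse, so a displacement
    count on lifts to the line shows that Phi maps each of them to a
    homeomorphism with a fixed point.  Commuting circle homeomorphisms with
    fixed points have a common one, hence the image of the Borel subgroup B
    fixes a point p0.  Then g B |-> Phi(g) p0 is an equivariant map h from RP^1
    to the circle.  Conjugation by the diagonal subgroup forces its restriction
    to the affine line, an orbit of the unipotent subgroup, to be strictly
    monotone; a monotone function has a continuity point, so by homogeneity h
    is a homeomorphism.

    For the regularity of h let H lift h, with inverse G, and consider the flow
    F_t = H(G + t) of lifts of the C^p maps Phi(rotation by t), p >= 2.  By
    Baire's theorem the C^2 bounds on F_t are uniform in t, and since H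
    commutes with the deck translation, the mean of F_t over a period is G plus
    a constant: so G, and then H, is C^1 with nonvanishing derivative.  Finally
    u = ln H' satisfies u(x + t) - u(x) = ln (F_t' (H x)), and a continuous
    periodic function all of whose differences are C^1 is itself C^1 (Baire
    again); this bootstraps H to C^p. *)

Set Implicit Arguments.
Unset Strict Implicit.
Unset Printing Implicit Defensive.

Import Order.TTheory GRing.Theory Num.Theory.
Import numFieldNormedType.Exports.

Local Open Scope classical_set_scope.
Local Open Scope ring_scope.

Local Notation tau R := ((pi : R) *+ 2).

(** * Real functions *)

Section RealLine.
Variable R : realType.
Implicit Types f g : R -> R.

(** If no [E n] contained a segment, the complements would be open and dense, and by Baire's theorem
    some point would escape the whole cover. *)
Lemma baire_closed_cover (E : nat -> set R) :
  (forall n, closed (E n)) -> (forall t, exists n, E n t) ->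
  exists n c r, 0 < r /\ forall t, `|t - c| <= r -> E n t.
Proof.
move=> cE covE; apply: contrapT => noE.
have dE : dense (\bigcap_n (~` E n)).
  apply: (@Baire R R) => n; split; first exact/closed_openC/cE.
  move=> O [c Oc] Oo; have /nbhs_ballP[r /= r0 cO] := open_nbhs_nbhs (conj Oo Oc).
  apply: contrapT => ON; apply: noE; exists n, c, (r / 2); split.
    by rewrite divr_gt0.
  move=> t tc; apply: contrapT => Et; apply: ON; exists t; split => //.
  apply: cO; rewrite /ball/= distrC (le_lt_trans tc)//.
  by rewrite ltr_pdivrMr// ltr_pMr// ltr1n.
have [|//|t [_ tE]] := dE setT; first by exists 0.
  exact: openT.
by have [n Et] := covE t; exact: (tE n).
Qed.

Lemma continuous_eps f x : {for x, continuous f} <->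
  forall e, 0 < e -> exists2 d, 0 < d & forall y, `|y - x| < d -> `|f y - f x| < e.
Proof.
split=> [/cvgrPdist_lt fc e e0|H].
  have /nbhs_ballP[d /= d0 dP] := fc _ e0.
  by exists d => // y yx; rewrite distrC; apply: dP; rewrite /ball/= distrC.
apply/cvgrPdist_lt => e e0; have [d d0 dP] := H _ e0.
by apply/nbhs_ballP; exists d => //= y; rewrite /ball/= distrC => /dP; rewrite distrC.
Qed.

Lemma is_derive_eps f x l :
  (forall e, 0 < e -> exists2 d, 0 < d &
    forall s, s != 0 -> `|s| < d -> `|(f (x + s) - f x) / s - l| <= e) ->
  is_derive x (1 : R) f l.
Proof.
move=> H.
suff C : h^-1 *: ((f \o shift x) (h *: (1 : R)) - f x) @[h --> 0^'] --> l.
  by apply: DeriveDef; [apply/cvg_ex; exists l|exact/cvg_lim].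
apply/cvgrPdist_le => e e0; have [d d0 dP] := H _ e0.
apply/nbhs_ballP; exists d => //= s; rewrite /ball/= sub0r normrN => sd s0.
by rewrite distrC scaler1 /GRing.scale/= (addrC s) mulrC; exact: dP.
Qed.

Lemma derive_eps f x l : is_derive x (1 : R) f l ->
  forall e, 0 < e -> exists2 d, 0 < d &
    forall s, s != 0 -> `|s| < d -> `|(f (x + s) - f x) / s - l| <= e.
Proof.
case=> fd fl e e0.
have : h^-1 *: ((f \o shift x) (h *: (1 : R)) - f x) @[h --> 0^'] --> l.
  by rewrite -fl; exact: fd.
move=> /cvgrPdist_le/(_ _ e0)/nbhs_ballP[d /= d0 dP]; exists d => // s s0 sd.
have := dP s; rewrite /ball/= sub0r normrN => /(_ sd s0).
by rewrite distrC scaler1 /GRing.scale/= (addrC s) mulrC.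
Qed.

(* A jump at every point would give an injection of R into rat * bool, sending
   x to a rational inside a jump at x and the side of that jump. *)
Lemma monotone_continuity_point f : {homo f : x y / x <= y} ->
  exists x, {for x, continuous f}.
Proof.
move=> f_le; apply: contrapT => noc.
have jump x : exists qb : rat * bool,
    if qb.2 then f x < ratr qb.1 /\ forall y, x < y -> ratr qb.1 < f y
    else ratr qb.1 < f x /\ forall y, y < x -> f y < ratr qb.1.
  apply: contrapT => noq; apply: noc; exists x; apply/continuous_eps => e e0.
  have [q1] := rat_in_itvoo (ltr_pwDr e0 (lexx (f x))).
  have [q2] := rat_in_itvoo (ltr_pwDl e0 (lexx (f x - e))).
  rewrite !in_itv/= addrCA subrr addr0 => /andP[q2l q2r] /andP[q1l q1r].
  have [y1 xy1 fy1] : exists2 y, x < y & f y <= ratr q1.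
    apply: contrapT => no; apply: noq; exists (q1, true); split => // y xy.
    by rewrite ltNge; apply/negP => fy; apply: no; exists y.
  have [y2 xy2 fy2] : exists2 y, y < x & ratr q2 <= f y.
    apply: contrapT => no; apply: noq; exists (q2, false); split => // y xy.
    by rewrite ltNge; apply/negP => fy; apply: no; exists y.
  exists (Num.min (y1 - x) (x - y2)); first by rewrite lt_min !subr_gt0 xy1.
  move=> y; rewrite lt_min !ltr_norml => /andP[/andP[_ a] /andP[b _]].
  have /f_le : y <= y1 by lra.
  have /f_le : y2 <= y by lra.
  by move=> ? ?; apply/andP; split; lra.
have [g gP] := choice jump.
have g_inj : injective g.
  suff lt_neq x y : x < y -> g x <> g y.
    by move=> x y gxy; have [H|H|//] := ltgtP x y; case: (lt_neq _ _ H).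
  move=> xy gxy; have := gP x; have := gP y; rewrite gxy.
  case: ifP => _ [a b] [c d]; first by have := d _ xy; lra.
  by have := b _ xy; lra.
(* Baire's theorem stands in for uncountability: each fibre of [pickle \o g] has at most one point,
   hence is closed, so one of them would contain a segment. *)
have [n [c [r [r0 En]]]] : exists n c r, 0 < r /\
    forall t, `|t - c| <= r -> pickle (g t) = n.
  apply: (@baire_closed_cover (fun n => [set t | pickle (g t) = n])); last first.
    by move=> t; exists (pickle (g t)).
  move=> n; have [[t tn]|no] := pselect (exists t, pickle (g t) = n).
    rewrite (_ : mkset _ = [set t]); first exact: closed_eq.
    apply/seteqP; split => [u /= un|u /= -> //].
    by apply: g_inj; apply: (pcan_inj (@pickleK _)); rewrite un tn.
  rewrite (_ : mkset _ = set0); first exact: closed0.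
  by apply/seteqP; split => // u un; apply: no; exists u.
have : c = c + r.
  apply: g_inj; apply: (pcan_inj (@pickleK _)); rewrite En; last by rewrite subrr normr0 ltW.
  by rewrite En// addrC addKr ger0_norm// ltW.
by move/eqP; rewrite -subr_eq0 opprD addNKr oppr_eq0 gt_eqF.
Qed.

Lemma ivt f a b v : continuous f -> f a <= v <= f b -> exists c, f c = v.
Proof.
move=> fc /andP[av vb]; have [ab|/ltW ba] := leP a b.
  have [||c _ cv] := @IVT _ f _ _ v ab; last by exists c.
    exact/continuous_subspaceT.
  by rewrite ge_min le_max av vb orbT.
have [||c _ cv] := @IVT _ f _ _ v ba; last by exists c.
  exact/continuous_subspaceT.
by rewrite ge_min le_max av vb orbT.
Qed.

Lemma fixpoint_free_sign f : continuous f -> (forall x, f x <> x) ->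
  (forall x, x < f x) \/ (forall x, f x < x).
Proof.
move=> fc nofix; have [[a fa]|no] := pselect (exists a, f a < a); last first.
  left=> x; have [//|fx|/esym/nofix//] := ltgtP x (f x); by case: no; exists x.
right=> x; have [//|xf|/nofix//] := ltgtP (f x) x.
have [||c /subr0_eq/nofix//] := @ivt (fun x => f x - x) a x 0.
  by move=> y; apply: cvgB; [exact: fc|exact: cvg_id].
by rewrite subr_le0 subr_ge0 !ltW.
Qed.

(** The orbit of [x] is monotone, in the direction given by comparing [x] with [f x]. Being bounded
    it converges; the limit is fixed by continuity and in [S] by closedness. *)
Lemma iter_cvg_fixpoint f (S : set R) x M : continuous f ->
  {homo f : x y / x <= y} -> closed S -> (forall y, S y -> S (f y)) -> S x ->
  (forall n, `|iter n f x| <= M) -> exists2 l, S l & f l = l.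
Proof.
move=> fc f_le Sc fS Sx xM.
have Sn n : S (iter n f x) by elim: n => //= n IH; exact: fS.
suff cv : cvgn (fun n => iter n f x).
  exists (limn (fun n => iter n f x)).
    by apply: (closed_cvg _ Sc _ _ cv) => //; exact: nearW.
  have c1 : iter n.+1 f x @[n --> \oo] --> f (limn (fun n => iter n f x)).
    by apply: (@cvg_comp _ _ _ (fun n => iter n f x) f _ _ _ cv); exact: fc.
  apply: (cvg_unique _ c1) => //.
  exact: (@cvg_comp _ _ _ (addn 1) (fun n => iter n f x) _ _ _ (cvg_addnl 1) cv).
have [xfx|/ltW fxx] := leP x (f x).
  apply: nondecreasing_is_cvgn; first apply/nondecreasing_seqP.
    by elim=> // n IH /=; exact: f_le.
  by exists M => _ [n _ <-]; exact: le_trans (ler_norm _) (xM n).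
apply: nonincreasing_is_cvgn; first apply/nonincreasing_seqP.
  by elim=> // n IH /=; exact: f_le.
by exists (- M) => _ [n _ <-]; have := xM n; rewrite ler_norml => /andP[].
Qed.

End RealLine.

(** * Stability of the classes C^k, and periodic functions *)

Section Regularity.
Variable R : realType.
Implicit Types f g v : R -> R.

Lemma CkW_le j k f : (j <= k)%N -> Ck k f -> Ck j f.
Proof. by move=> /subnK <-; elim: (k - j)%N => // n IH /CkW/IH. Qed.

Lemma Ck_comp k f g : Ck k f -> Ck k g -> Ck k (f \o g).
Proof.
elim: k f => [|k IH] f fk gk.
  by apply/Ck0 => x; apply: continuous_comp; exact/(Ck0 _).1.
have [fk' fd] := CkS_derive fk; have [gk' gd] := CkS_derive gk.
by apply: (CkS_is_derive _ (CkM (IH _ fk' (CkW gk)) gk')).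
Qed.

Lemma Ck_expR k : Ck k (@expR R).
Proof.
elim: k => [|k IH]; first exact/Ck0/continuous_expR.
exact: (CkS_is_derive _ IH).
Qed.

Lemma Ck_ln k f : (forall x, 0 < f x) -> Ck k f -> Ck k (fun x => ln (f x)).
Proof.
move=> f0; elim: k => [|k IH] fk.
  by apply/Ck0 => x; apply: continuous_comp; [exact: (Ck0 _).1|exact: continuous_ln].
have [fk' fd] := CkS_derive fk.
have fV : Ck k (fun x => (f x)^-1) by apply: CkV (CkW fk) => x; rewrite gt_eqF.
apply: (CkS_is_derive _ (CkM fV fk')) => x.
exact: (is_derive1_comp (is_derive1_ln (f0 x)) (fd x)).
Qed.

(** The derivative of [g] is the inverse of [derive1 f \o g], so each degree of regularity of [g]
    yields the next. *)
Lemma Ck_inverse k f g : cancel f g -> cancel g f -> Ck k.+1 f ->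
  (forall x, derive1 f x != 0) -> Ck k.+1 g.
Proof.
move=> fK gK fk f'0; have [fk' fd] := CkS_derive fk.
have gd y : is_derive y (1 : R) g (derive1 f (g y))^-1.
  rewrite -{1}(gK y); apply: is_derive_inverse (fd _) (f'0 _).
    by apply: filterE => z; exact: fK.
  by apply: filterE => z; exact: (Ck_cont fk).
have gc : continuous g.
  by apply: derivable_continuous => y; exact: ex_derive.
elim: k {fk} fk' => [|k IH] fk'.
  apply: (CkS_is_derive gd).
  exact: (CkV (fun y => f'0 (g y)) (Ck_comp fk' ((Ck0 g).2 gc))).
apply: (CkS_is_derive gd).
exact: (CkV (fun y => f'0 (g y)) (Ck_comp fk' (IH (CkW fk')))).
Qed.

Lemma derivative_bounds k f x y : Ck k.+1 f -> x < y ->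
  exists2 c, x < c < y & f y - f x = derive1 f c * (y - x).
Proof.
move=> fk xy; have [_ fd] := CkS_derive fk.
have [c cI cE] := MVT xy (fun z _ => fd z) (continuous_subspaceT (Ck_cont fk)).
by exists c => //; move: cI; rewrite in_itv.
Qed.

(** Only [x] is confined to the segment. Compactness enters as a near-covering property, with [d]
    tending to 0 from the right. *)
Lemma unif_cont_segment f a b e : continuous f -> 0 < e ->
  exists2 d, 0 < d & forall x y, a <= x <= b -> `|y - x| < d -> `|f y - f x| < e.
Proof.
move=> fc e0.
have := (@compact_near_coveringP R^o `[a, b]).1 (@segment_compact _ a b).
move=> /(_ R (0 : R)^'+ (fun d x => forall y, `|y - x| < d -> `|f y - f x| < e)).
move=> /(_ _)[] => [x _|d /= d0 dP]; last first.
  exists (d / 2); first by rewrite divr_gt0.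
  move=> x y xab; apply: (dP (d / 2)); rewrite ?divr_gt0//=.
  by rewrite sub0r normrN gtr0_norm ?divr_gt0// ltr_pdivrMr// ltr_pMr// ltr1n.
have [d d0 dP] := (continuous_eps f x).1 (fc x) _ (divr_gt0 e0 (ltr0n _ 2)).
have d20 : 0 < d / 2 by rewrite divr_gt0.
exists (ball x (d / 2), [set u | u < d / 2]) => /=.
  by split; [exact: nbhsx_ballx|exact: nbhs_right_lt].
move=> [x' u] /= [xx' ud] y yx'.
have A : `|f x' - f x| < e / 2.
  by apply: dP; rewrite distrC; apply: lt_trans xx' _; lra.
have B : `|f y - f x| < e / 2.
  apply: dP; rewrite -(subrKA x') (le_lt_trans (ler_normD _ _))//.
  by move: xx'; rewrite /ball/= distrC => xx'; lra.
rewrite -(subrKA (f x)) (le_lt_trans (ler_normD _ _))//.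
by rewrite -(distrC (f x')) ; lra.
Qed.

Lemma shift_in_period (P x : R) : 0 < P -> exists k : int, 0 <= x - P * k%:~R < P.
Proof.
move=> P0; exists (Num.floor (x / P)); have /andP[A B] := floor_itv (x / P).
rewrite subr_ge0 mulrC -ler_pdivlMr// A/= ltrBlDl.
by move: B; rewrite intrD ltr_pdivrMr// mulrDl mul1r addrC.
Qed.

Section Periodic.
Variables (P : R).
Hypothesis P0 : 0 < P.

Definition has_period f := forall x, f (x + P) = f x.

Lemma periodic_int f (k : int) x : has_period f -> f (x + P * k%:~R) = f x.
Proof.
move=> fP; have fPn (n : nat) y : f (y + P * n%:R) = f y.
  elim: n y => [|n IH] y; first by rewrite mulr0 addr0.
  by rewrite -natr1 mulrDr mulr1 addrA fP.
case: k => n; first exact: fPn.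
rewrite NegzE -[in RHS](subrK (P * n.+1%:R) x) fPn.
by rewrite mulrNz mulrN.
Qed.

Lemma periodic_bounded f : continuous f -> has_period f ->
  exists2 M, 0 < M & forall x, `|f x| <= M.
Proof.
move=> fc fP; have c0P := continuous_subspaceT fc.
have [c1 _ c1P] := EVT_max (ltW P0) (c0P [set` `[0, P]]).
have [c2 _ c2P] := EVT_min (ltW P0) (c0P [set` `[0, P]]).
exists (1 + `|f c1| + `|f c2|); first by rewrite -addrA ltr_wpDr ?addr_ge0.
move=> x; have [k /andP[k0 kP]] := shift_in_period x P0.
have kI : x - P * k%:~R \in `[0, P] by rewrite in_itv/= k0 ltW.
have := c1P _ kI; have := c2P _ kI.
rewrite -(periodic_int k (x - _) fP) subrK.
move: (ler_norm (f c1)) (ler_norm (- f c2)); rewrite normrN => a b c d.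
by rewrite ler_norml; apply/andP; split; have := normr_ge0 (f c1); have := normr_ge0 (f c2); lra.
Qed.

Lemma periodic_extrema f : continuous f -> has_period f ->
  exists c1 c2, forall x, f c1 <= f x <= f c2.
Proof.
move=> fc fP; have c0P := continuous_subspaceT fc.
have [c2 _ c2P] := EVT_max (ltW P0) (c0P [set` `[0, P]]).
have [c1 _ c1P] := EVT_min (ltW P0) (c0P [set` `[0, P]]).
exists c1, c2 => x; have [k /andP[k0 kP]] := shift_in_period x P0.
have kI : x - P * k%:~R \in `[0, P] by rewrite in_itv/= k0 ltW.
rewrite -(subrK (P * k%:~R) x) (periodic_int k _ fP).
by rewrite c1P// c2P.
Qed.

Lemma periodic_unif_cont f e : continuous f -> has_period f -> 0 < e ->
  exists2 d, 0 < d & forall x y, `|y - x| < d -> `|f y - f x| < e.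
Proof.
move=> fc fP e0; have [d d0 dP] := unif_cont_segment 0 P fc e0.
exists d => // x y yx; have [k /andP[k0 kP]] := shift_in_period x P0.
rewrite -(subrK (P * k%:~R) x) -(subrK (P * k%:~R) y) !(periodic_int k _ fP).
by apply: dP; rewrite ?k0 ?ltW// opprB addrA subrK.
Qed.

Lemma periodic_derive1 f : has_period f -> has_period (derive1 f).
Proof.
move=> fP x; rewrite -!(derive1_shift f); congr (derive1 _ _).
by apply/funext => t; rewrite addrA fP.
Qed.

Lemma equivariant_derive1 f : (forall x, f (x + P) = f x + P) ->
  (forall x, derivable f x 1) -> has_period (derive1 f).
Proof.
move=> fP fd x.
have fdE y : is_derive y (1 : R) f (derive1 f y) by rewrite derive1E; exact: derivableP.
have S : is_derive x (1 : R) (fun y => y + P) 1.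
  by have := is_deriveD (is_derive_id x (1 : R)) (is_derive_cst P x 1); rewrite addr0.
have A := @is_derive1_comp R f (fun y => y + P) x _ _ (fdE (x + P)) S.
have B : is_derive x (1 : R) (f \o (fun y => y + P)) (derive1 f x).
  rewrite (_ : f \o _ = f \+ cst P); last by apply/funext => y /=; rewrite fP.
  by have := is_deriveD (fdE x) (is_derive_cst P x 1); rewrite addr0.
by rewrite -(@derive_val _ _ _ _ _ _ _ B) -[LHS]mulr1 (@derive_val _ _ _ _ _ _ _ A).
Qed.

End Periodic.
End Regularity.

(** * The difference property *)

Section DifferenceProperty.
Variable R : realType.
Implicit Types f g v : R -> R.

Definition diff_quot f s x : R := (f (x + s) - f x) / s.

(* The derivative is built as the supremum of the eventual lower bounds of the
   right difference quotients. *)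
Lemma unif_quot_Ck1 v : continuous v ->
  (forall e, 0 < e -> exists2 d, 0 < d & forall x s s', 0 < s <= d -> 0 < s' <= d ->
    `|diff_quot v s x - diff_quot v s' x| <= e) ->
  Ck 1 v.
Proof.
move=> vc H.
pose L x := [set y | exists2 d, 0 < d & forall s, 0 < s <= d -> y <= diff_quot v s x].
pose w x := sup (L x).
(* Quotients that stay within [e] of the one of step [s] keep the supremum [w x] within [e] of it as
   well. *)
have wP e d x s : (forall s', 0 < s' <= d -> `|diff_quot v s x - diff_quot v s' x| <= e) ->
    0 < s <= d -> `|diff_quot v s x - w x| <= e.
  move=> se sd.
  have Lx : L x (diff_quot v s x - e).
    exists d; first by case/andP: sd => /lt_le_trans; apply.
    by move=> s' /se; rewrite ler_norml => /andP[] _; lra.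
  have ubx : ubound (L x) (diff_quot v s x + e).
    move=> y [d' d'0 yd'].
    have m0 : 0 < Num.min d d'.
      by rewrite lt_min d'0 andbT; case/andP: sd => /lt_le_trans; apply.
    have := yd' (Num.min d d'); have := se (Num.min d d').
    rewrite !m0 !ge_min !lexx orbT /= => /(_ isT) + /(_ isT).
    by rewrite ler_norml => /andP[]; lra.
  have A : w x <= diff_quot v s x + e by apply: ge_sup => //; exists (diff_quot v s x - e).
  have B : diff_quot v s x - e <= w x.
    by apply: ub_le_sup => //; exists (diff_quot v s x + e).
  by rewrite ler_norml; apply/andP; split; lra.
have qc s : continuous (diff_quot v s).
  move=> x; apply: cvgM; last exact: cvg_cst.
  apply: cvgB; last exact: vc.
  apply: (@continuous_comp _ _ _ (fun x => x + s) v); last exact: vc.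
  by apply: cvgD; [exact: cvg_id|exact: cvg_cst].
(* [w] is a uniform limit of the continuous functions [diff_quot v d]. *)
have wc : continuous w.
  move=> x; apply/continuous_eps => e e0.
  have e4 : 0 < e / 4 by rewrite divr_gt0.
  have [d d0 dP] := H _ e4.
  have dd : 0 < d <= d by rewrite d0 lexx.
  have [r r0 rP] := (continuous_eps _ _).1 (qc d x) _ e4.
  exists r => // y /rP yx.
  have A z := @wP _ d z d (fun s' s'd => dP z d s' dd s'd) dd.
  have := A y; have := A x; move: yx; rewrite ltr_norml !ler_norml.
  by move=> /andP[? ?] /andP[? ?] /andP[? ?]; rewrite ltr_norml; apply/andP; split; lra.
apply: (@CkS_is_derive _ _ _ w); last exact/Ck0.
move=> x; apply: is_derive_eps => e e0.
have e4 : 0 < e / 2 by rewrite divr_gt0.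
have [d d0 dP] := H _ e4.
have [r r0 rP] := (continuous_eps _ _).1 (wc x) _ e4.
have W y s : 0 < s <= d -> `|diff_quot v s y - w y| <= e / 2.
  by move=> sd; apply: (@wP _ d) => // s' s'd; exact: dP.
exists (Num.min d r); first by rewrite lt_min d0.
move=> s s0; rewrite lt_min => /andP[sd sr].
have [sp|sn] := ltP 0 s.
  rewrite gtr0_norm// in sd; have := W x s; rewrite sp ltW// => /(_ isT) A.
  by apply: le_trans A _; lra.
(* The quotient at [x] with negative step [s] is the right quotient at [x + s] with step [- s];
   continuity of [w] brings the base point back to [x]. *)
have {}sn : 0 < - s by rewrite oppr_gt0 lt_neqAle s0.
rewrite -normrN gtr0_norm// in sd.
have := W (x + s) (- s); rewrite sn ltW// => /(_ isT).
rewrite /diff_quot addrK invrN mulrN -mulNr opprB => A.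
have B : `|w (x + s) - w x| < e / 2 by apply: rP; rewrite addrC addKr.
rewrite -(subrKA (w (x + s))) (le_trans (ler_normD _ _))//.
by move: A B => + /ltW; lra.
Qed.

Lemma uniform_min (Q : nat -> R -> Prop) :
  (forall j, exists2 d, 0 < d & Q j d) ->
  (forall j d d', 0 < d' <= d -> Q j d -> Q j d') ->
  forall N, exists2 d, 0 < d & forall j, (j <= N)%N -> Q j d.
Proof.
move=> Qex Qmono; elim=> [|N [d d0 dP]].
  by have [d d0 dP] := Qex 0%N; exists d => // j; rewrite leqn0 => /eqP ->.
have [d' d'0 d'P] := Qex N.+1; have m0 : 0 < Num.min d d' by rewrite lt_min d0.
exists (Num.min d d') => // j; rewrite leq_eqVlt ltnS => /predU1P[->|/dP jd].
  by apply: Qmono d'P; rewrite m0 ge_min lexx orbT.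
by apply: Qmono jd; rewrite m0 ge_min lexx.
Qed.

Variable P : R.
Hypothesis P0 : 0 < P.

(** By the mean value theorem each quotient is a nearby value of the derivative, which is uniformly
    continuous by periodicity. *)
Lemma periodic_Ck1_unif_quot v e : Ck 1 v -> has_period P v -> 0 < e ->
  exists2 d, 0 < d & forall x s s', 0 < s <= d -> 0 < s' <= d ->
    `|diff_quot v s x - diff_quot v s' x| <= e.
Proof.
move=> v1 vP e0; have [/Ck0 v'c vd] := CkS_derive v1.
have v'P := periodic_derive1 vP.
have e2 : 0 < e / 2 by rewrite divr_gt0.
have [d d0 dP] := periodic_unif_cont P0 v'c v'P e2.
have q x s : 0 < s <= d -> `|diff_quot v s x - derive1 v x| <= e / 2.
  move=> /andP[s0 sd]; have xs : x < x + s by rewrite ltrDl.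
  have [c /andP[xc cs] cE] := derivative_bounds v1 xs.
  rewrite /diff_quot cE [x + s]addrC addrK mulfK ?gt_eqF// ltW// dP//.
  by rewrite gtr0_norm; lra.
exists d => // x s s' /(q x) A /(q x) B.
rewrite -(subrKA (derive1 v x)) (le_trans (ler_normD _ _))//.
by move: B; rewrite distrC; lra.
Qed.

(* With x + s' a maximum (minimum) of v, the difference of the two quotients is
   a positive combination of v (x + s) - max v and v x - max v. *)
Lemma quot_sub_sign v s s' : continuous v -> has_period P v -> 0 < s' < s ->
  (exists x, diff_quot v s x - diff_quot v s' x <= 0) /\
  (exists x, 0 <= diff_quot v s x - diff_quot v s' x).
Proof.
move=> vc vP /andP[s'0 ss']; have s0 := lt_trans s'0 ss'.
have [c1 [c2 cP]] := periodic_extrema P0 vc vP.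
have a0 : 0 < s^-1 by rewrite invr_gt0.
have b0 : 0 < s'^-1 - s^-1 by rewrite subr_gt0 ltf_pV2.
have E c : diff_quot v s (c - s') - diff_quot v s' (c - s') =
    s^-1 * (v (c - s' + s) - v c) + (s'^-1 - s^-1) * (v (c - s') - v c).
  by rewrite /diff_quot subrK; ring.
split; [exists (c2 - s')|exists (c1 - s')]; rewrite E.
  have /andP[_ A] := cP (c2 - s' + s); have /andP[_ B] := cP (c2 - s').
  by nra.
have /andP[A _] := cP (c1 - s' + s); have /andP[B _] := cP (c1 - s').
by nra.
Qed.

(** The quotients of [D t] are Cauchy at a scale that Baire's theorem makes uniform for [t] in a
    segment, and the cocycle identity then for all [t]. Hence the gap between two quotients of [v]
    varies by at most [e] from point to point; as it takes both signs, it is at most [e]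
    everywhere. *)
Lemma difference_property v : continuous v -> has_period P v ->
  (forall t, Ck 1 (fun x => v (x + t) - v x)) -> Ck 1 v.
Proof.
move=> vc vP vt; apply: unif_quot_Ck1 => // e e0.
pose D t x := v (x + t) - v x.
pose Q e t d := forall x s s', 0 < s <= d -> 0 < s' <= d ->
  `|diff_quot (D t) s x - diff_quot (D t) s' x| <= e.
have e2 : 0 < e / 2 by rewrite divr_gt0.
have QD t : exists2 d, 0 < d & Q (e / 2) t d.
  apply: periodic_Ck1_unif_quot => //; first exact: vt.
  by move=> x; rewrite /D addrAC !vP.
have Qmono t d d' : 0 < d' <= d -> Q (e / 2) t d -> Q (e / 2) t d'.
  by move=> /andP[_ dd] q x s s' /andP[a b] /andP[a' b']; apply: q;
    rewrite ?a ?a' (le_trans _ dd).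
have [n [c [r [r0 En]]]] : exists n c r, 0 < r /\
    forall t, `|t - c| <= r -> Q (e / 2) t n.+1%:R^-1.
  apply: (@baire_closed_cover _ (fun n t => Q (e / 2) t n.+1%:R^-1)).
    move=> n; rewrite (_ : (fun t => _) = \bigcap_(z in
        [set z : R * R * R | 0 < z.1.2 <= n.+1%:R^-1 /\ 0 < z.2 <= n.+1%:R^-1])
        [set t | `|diff_quot (D t) z.1.2 z.1.1 - diff_quot (D t) z.2 z.1.1| <= e / 2]).
      apply: closed_bigI => -[[x s] s'] _ /=.
      apply: (@preimage_closed _ _ (fun t => `|diff_quot (D t) s x - diff_quot (D t) s' x|)
        [set y | y <= e / 2]); last exact: closed_le.
      have Dc y : continuous (fun t => D t y).
        move=> t; apply: cvgB; last exact: cvg_cst.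
        apply: (@continuous_comp _ _ _ (fun t => y + t) v); last exact: vc.
        by apply: cvgD; [exact: cvg_cst|exact: cvg_id].
      have qc s0 : continuous (fun t => diff_quot (D t) s0 x).
        by move=> t; apply: cvgM; [apply: cvgB; exact: Dc|exact: cvg_cst].
      move=> t _; apply: (@continuous_comp _ _ _
        (fun t => diff_quot (D t) s x - diff_quot (D t) s' x) (fun y : R => `|y|)); last exact: norm_continuous.
      by apply: cvgB; exact: qc.
    apply/seteqP; split => [t tQ [[x s] s'] /= [a b]|t tQ x s s' a b]; first exact: tQ.
    exact: (tQ (x, s, s')).
  move=> t; have [d d0 dQ] := QD t; exists (Num.truncn d^-1).
  apply: Qmono dQ; rewrite invr_gt0 ltr0n/= invf_ple ?posrE// ltW//.
  exact: truncnS_gt.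
(* Every point of [[0, P)] lies less than [r] above one of the finitely many multiples [j * r] in
   this range. *)
have [d d0 dP] := uniform_min (Q := fun j => Q (e / 2) (j%:R * r))
  (fun j => QD _) (fun j => Qmono _) (Num.truncn (P / r)).
have Qall t x s s' : 0 < s <= Num.min d n.+1%:R^-1 -> 0 < s' <= Num.min d n.+1%:R^-1 ->
    `|diff_quot (D t) s x - diff_quot (D t) s' x| <= e.
  rewrite !le_min => /and3P[s0 sd sn] /and3P[s'0 s'd s'n].
  have [k] := shift_in_period (t - c) P0.
  set u := t - c - P * k%:~R => /andP[u0 uP].
  have vt' y : v (y + t) = v (y + (c + u)).
    by rewrite -(periodic_int k (y + (c + u)) vP) /u; congr v; ring.
  have ur0 : 0 <= u / r by rewrite divr_ge0// ltW.
  have /andP[ju uj] := truncn_itv ur0.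
  set j := Num.truncn (u / r) in ju uj.
  have jP : (j <= Num.truncn (P / r))%N by rewrite le_truncn// ler_pM2r ?invr_gt0// ltW.
  rewrite ler_pdivlMr// in ju; rewrite ltr_pdivrMr// -natr1 mulrDl mul1r in uj.
  set a := c + (u - j%:R * r).
  have aE : `|a - c| <= r by rewrite /a [c + _]addrC addrK ler_norml; apply/andP; split; lra.
  (* The cocycle identity [D (j * r + a) x = D (j * r) (x + a) + D a x]; periodicity absorbs the
     difference between [t] and [c + u]. *)
  have quotD z : diff_quot (D t) z x = diff_quot (D (j%:R * r)) z (x + a) + diff_quot (D a) z x.
    rewrite /diff_quot /D !vt' -mulrDl; congr (_ / _).
    rewrite (_ : x + z + (c + u) = x + a + z + j%:R * r); last by rewrite /a; ring.
    rewrite (_ : x + (c + u) = x + a + j%:R * r); last by rewrite /a; ring.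
    by rewrite (addrAC x z a); ring.
  have A := dP j jP (x + a) s s'; rewrite s0 s'0 sd s'd in A.
  have B := En a aE x s s'; rewrite s0 s'0 sn s'n in B.
  rewrite !quotD (_ : _ - _ = (diff_quot (D (j%:R * r)) s (x + a) - diff_quot (D (j%:R * r)) s' (x + a))
    + (diff_quot (D a) s x - diff_quot (D a) s' x)); last by ring.
  rewrite (le_trans (ler_normD _ _))//.
  by have := A isT isT; have := B isT isT; lra.
have le_e s s' x : 0 < s' < s -> s <= Num.min d n.+1%:R^-1 ->
    `|diff_quot v s x - diff_quot v s' x| <= e.
  move=> s's sd; have /andP[s'0 ss'] := s's.
  have [[x1 x1P] [x2 x2P]] := quot_sub_sign vc vP s's.
  (* The change of the gap of [v] from [x] to [z] is the gap of [D (z - x)] at [x]. *)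
  have Dq z : `|(diff_quot v s (x + (z - x)) - diff_quot v s' (x + (z - x))) -
      (diff_quot v s x - diff_quot v s' x)| <= e.
    have := Qall (z - x) x s s'; rewrite sd s'0 (lt_trans s'0 ss')/=.
    rewrite (le_trans (ltW ss') sd) => /(_ isT isT); congr (`|_| <= e).
    by rewrite /diff_quot /D !(addrAC x (z - x)); ring.
  have := Dq x1; have := Dq x2; rewrite !(addrC x) !subrK !ler_norml.
  by move=> /andP[? ?] /andP[? ?]; apply/andP; split; lra.
exists (Num.min d n.+1%:R^-1); first by rewrite lt_min d0 invr_gt0 ltr0n.
move=> x s s' /andP[s0 sd] /andP[s'0 s'd].
have [ss'|s's|->] := ltgtP s s'; last by rewrite subrr normr0 ltW.
  by rewrite distrC; apply: le_e => //; rewrite s0.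
by apply: le_e => //; rewrite s'0.
Qed.

(** Induction on [k]: the differences of the derivative are the derivatives of the differences. *)
Lemma difference_property_Ck k v : Ck k v -> has_period P v ->
  (forall t, Ck k.+1 (fun x => v (x + t) - v x)) -> Ck k.+1 v.
Proof.
elim: k v => [|k IH] v vk vP vt; first by apply: difference_property => //; exact/Ck0.
have [vk' vd] := CkS_derive vk; apply: (CkS_is_derive vd).
apply: IH => // [|t]; first exact: periodic_derive1.
have [+ _] := CkS_derive (vt t); congr Ck; apply/funext => x; rewrite derive1E.
have S : is_derive x (1 : R) (fun y => y + t) 1.
  by have := is_deriveD (is_derive_id x (1 : R)) (is_derive_cst t x 1); rewrite addr0.
have A := @is_derive1_comp R v (fun y => y + t) x _ _ (vd (x + t)) S.
by rewrite (@derive_val _ _ _ _ _ _ _ (is_deriveB A (vd x))) mulr1.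
Qed.

End DifferenceProperty.

(** * Regularity of conjugacies between circle flows *)

Section Conjugacy.
Variable R : realType.
Variable P : R.
Hypothesis P0 : 0 < P.

Let addrCK (x y : R) : x + y - x = y.
Proof. by rewrite addrC addKr. Qed.

(* A C^1 bound and a Lipschitz bound on the derivative, phrased with difference
   quotients so as to be closed under pointwise limits. *)
Definition C11 (N : R) (f : R -> R) :=
  (forall y z, `|f y - f z| <= N * `|y - z|) /\
  (forall y s s', 0 < s -> 0 < s' -> `|diff_quot f s y - diff_quot f s' y| <= N * (s + s')).

Lemma C11_le M N f : M <= N -> C11 M f -> C11 N f.
Proof.
move=> MN [a b]; split=> [y z|y s s' s0 s'0].
  by apply: le_trans (a y z) _; rewrite ler_wpM2r.
by apply: le_trans (b y s s' s0 s'0) _; rewrite ler_wpM2r// addr_ge0// ltW.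
Qed.

Lemma C11_quot N f s y : C11 N f -> 0 < s -> `|diff_quot f s y| <= N.
Proof.
move=> [a _] s0; rewrite /diff_quot normrM normrV ?unitfE ?gt_eqF// (gtr0_norm s0).
by rewrite ler_pdivrMr//; have := a (y + s) y; rewrite addrCK (gtr0_norm s0).
Qed.

(** As [g] increases, positive steps stay positive and the chain rule is exact for quotients. The
    term [M * N ^+ 2] comes from varying the quotient of [f], the term [M * N] from varying that of
    [g]. *)
Lemma C11_comp M N f g : 0 <= M -> 0 <= N -> {homo g : x y / x < y} ->
  C11 M f -> C11 N g -> C11 (M * N + M * N ^+ 2) (f \o g).
Proof.
move=> M0 N0 g_lt fM gN; have [fl fq] := fM; have [gl gq] := gN.
split=> [y z|y s s' s0 s'0] /=.
  apply: le_trans (fl _ _) _.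
  apply: (@le_trans _ _ (M * (N * `|y - z|))); first exact: ler_wpM2l (gl _ _).
  by rewrite mulrA ler_wpM2r// lerDl mulr_ge0 ?exprn_ge0.
have inc u : 0 < u -> 0 < g (y + u) - g y <= N * u.
  move=> u0; rewrite subr_gt0 g_lt ?ltrDl//=.
  apply: le_trans (ler_norm _) _; apply: le_trans (gl _ _) _.
  by rewrite addrCK gtr0_norm.
have /andP[a0 aN] := inc _ s0; have /andP[b0 bN] := inc _ s'0.
set a := g (y + s) - g y in a0 aN *; set b := g (y + s') - g y in b0 bN *.
have E u : 0 < g (y + u) - g y ->
    diff_quot (f \o g) u y = diff_quot f (g (y + u) - g y) (g y) * diff_quot g u y.
  by move=> u0; rewrite /diff_quot/= (addrC (g y)) subrK mulrA divfK ?gt_eqF.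
rewrite !E// -/a -/b.
rewrite (_ : _ - _ = (diff_quot f a (g y) - diff_quot f b (g y)) * diff_quot g s y +
   diff_quot f b (g y) * (diff_quot g s y - diff_quot g s' y)); last by ring.
rewrite (le_trans (ler_normD _ _))//.
rewrite (normrM (diff_quot f a (g y) - _)) (normrM (diff_quot f b (g y))).
have A := fq (g y) a b a0 b0; have B := C11_quot y gN s0.
have C := C11_quot (g y) fM b0; have D := gq y s s' s0 s'0.
apply: (@le_trans _ _ (M * (a + b) * N + M * (N * (s + s')))).
  by apply: lerD; apply: ler_pM.
have : M * (a + b) * N <= M * (N * s + N * s') * N.
  by rewrite ler_wpM2r// ler_wpM2l// lerD.
by rewrite expr2; lra.
Qed.

(** The first two derivatives are periodic, hence bounded, and the mean value theorem applies. The
    bound is a natural number so that Baire's theorem can range over it. *)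
Lemma Ck2_C11 f : Ck 2 f -> (forall x, f (x + P) = f x + P) -> exists N : nat, C11 N%:R f.
Proof.
move=> f2 fP; have [f'1 fd] := CkS_derive f2; have [/Ck0 f''c f'd] := CkS_derive f'1.
have f'P : has_period P (derive1 f).
  apply: equivariant_derive1; first exact: fP.
  by move=> x; exact: ex_derive.
have [M1 M10 M1P] := periodic_bounded P0 (Ck_cont f'1) f'P.
have [M2 M20 M2P] := periodic_bounded P0 f''c (periodic_derive1 f'P).
have lip_of k g (M : R) : Ck k.+1 g -> (forall x, `|derive1 g x| <= M) ->
    forall y z, `|g y - g z| <= M * `|y - z|.
  move=> gk gM y z; wlog yz : y z / z < y => [hw|].
    have [/hw//|/hw|->] := ltgtP z y; last by rewrite !subrr normr0 mulr0.
    by rewrite distrC (distrC y).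
  have [c _ ->] := derivative_bounds gk yz.
  by rewrite normrM ler_wpM2r.
have MN : M1 + M2 <= (Num.truncn (M1 + M2)).+1%:R by exact/ltW/truncnS_gt.
exists (Num.truncn (M1 + M2)).+1; apply: C11_le MN _; split=> [y z|y s s' s0 s'0].
  apply: le_trans (lip_of _ _ _ f2 M1P y z) _.
  by rewrite ler_wpM2r// lerDl ltW.
have q u : 0 < u -> exists2 c, y < c < y + u & diff_quot f u y = derive1 f c.
  move=> u0; have yu : y < y + u by rewrite ltrDl.
  have [c cI cE] := derivative_bounds f2 yu; exists c => //.
  by rewrite /diff_quot cE addrCK mulfK// gt_eqF.
have [c /andP[c1 c2] ->] := q _ s0; have [c' /andP[c'1 c'2] ->] := q _ s'0.
apply: le_trans (lip_of _ _ _ f'1 M2P c c') _.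
have A : `|c - c'| <= s + s' by rewrite ler_norml; apply/andP; split; lra.
apply: le_trans (ler_wpM2l (ltW M20) A) _.
by rewrite ler_wpM2r ?lerDr ?ltW// addr_gt0.
Qed.

Variables H G : R -> R.
Hypothesis Hc : continuous H.
Hypothesis H_lt : {homo H : x y / x < y}.
Hypothesis HP : forall x, H (x + P) = H x + P.
Hypothesis HK : cancel H G.
Hypothesis GK : cancel G H.

Let flow t y := H (G y + t).

Let G_lt : {homo G : x y / x < y}.
Proof.
move=> x y xy; rewrite ltNge le_eqVlt; apply/negP => /predU1P[e|/H_lt].
  by move: xy; rewrite -(GK x) -(GK y) e ltxx.
by rewrite !GK => /lt_trans/(_ xy); rewrite ltxx.
Qed.

Let GP x : G (x + P) = G x + P.
Proof. by rewrite -[in LHS](GK x) -HP HK. Qed.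

Let flow_lt t : {homo flow t : x y / x < y}.
Proof. by move=> x y xy; rewrite /flow H_lt// ltrD2r G_lt. Qed.

Let flowP t x : flow t (x + P) = flow t x + P.
Proof. by rewrite /flow GP addrAC HP. Qed.

Let flowD s t x : flow s (flow t x) = flow (t + s) x.
Proof. by rewrite /flow HK addrA. Qed.

(** * From a C^2 flow to a C^1 conjugacy *)

Section FlowC2.
Hypothesis flow2 : forall t, Ck 2 (flow t).

(** Baire's theorem gives one bound for the times in a segment around [c]. Composing with
    [flow (- c)] moves this segment to 0, and finitely many compositions stretch it over a
    period. *)
Let flow_unif_C11 : exists2 A, 0 < A & forall t, 0 <= t <= P -> C11 A (flow t).
Proof.
have [n [c [r [r0 En]]]] : exists n c r, 0 < r /\
    forall t, `|t - c| <= r -> C11 n%:R (flow t).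
  apply: (@baire_closed_cover _ (fun n t => C11 n%:R (flow t))); last first.
    by move=> t; exact: Ck2_C11 (flow2 t) (flowP t).
  have fc y : continuous (fun t => flow t y).
    move=> t; apply: (@continuous_comp _ _ _ (fun t => G y + t) H); last exact: Hc.
    by apply: cvgD; [exact: cvg_cst|exact: cvg_id].
  have clos (u : R -> R) (C : R) : continuous u -> closed [set t | `|u t| <= C].
    move=> uc; apply: (@preimage_closed _ _ (fun t => `|u t|) [set y | y <= C]); last exact: closed_le.
    move=> t _; apply: (@continuous_comp _ _ _ u (fun y : R => `|y|)); first exact: uc.
    exact: norm_continuous.
  move=> n; rewrite (_ : (fun t => _) = (\bigcap_(z in @setT (R * R))
        [set t | `|flow t z.1 - flow t z.2| <= n%:R * `|z.1 - z.2|]) `&`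
      \bigcap_(z in [set z : R * R * R | 0 < z.1.2 /\ 0 < z.2])
        [set t | `|diff_quot (flow t) z.1.2 z.1.1 - diff_quot (flow t) z.2 z.1.1| <= n%:R * (z.1.2 + z.2)]).
    apply: closedI; apply: closed_bigI.
      by move=> z _; apply: clos => t; apply: cvgB; exact: fc.
    move=> [[y s] s'] /= _; apply: clos => t.
    by apply: cvgB; (apply: cvgM; [apply: cvgB; exact: fc|exact: cvg_cst]).
  apply/seteqP; split => [t [a b]|t [a b]]; split.
  - by move=> z _; exact: a.
  - by move=> [[y s] s'] /= [s0 s'0]; exact: b.
  - by move=> y z; exact: (a (y, z)).
  - by move=> y s s' s0 s'0; exact: (b (y, s, s')).
have [m mP] := Ck2_C11 (flow2 (- c)) (flowP (- c)).
have near0 : exists2 A, 0 <= A & forall s, `|s| <= r -> C11 A (flow s).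
  exists (n%:R * m%:R + n%:R * m%:R ^+ 2).
    by rewrite addr_ge0 ?mulr_ge0 ?exprn_ge0.
  move=> s sr; rewrite (_ : flow s = flow (c + s) \o flow (- c)).
    by apply: C11_comp => //; apply: En; rewrite addrCK.
  by apply/funext => y /=; rewrite flowD addKr.
have [A A0 AP] := near0.
have iter j : exists2 B, 0 <= B & forall s, `|s| <= r -> C11 B (flow (j.+1%:R * s)).
  elim: j => [|j [B B0 BP]]; first by exists A => // s /AP; rewrite mul1r.
  exists (A * B + A * B ^+ 2); first by rewrite addr_ge0 ?mulr_ge0 ?exprn_ge0.
  move=> s sr; rewrite (_ : flow _ = flow s \o flow (j.+1%:R * s)).
    by apply: C11_comp => //; [exact: AP|exact: BP].
  by apply/funext => y /=; rewrite flowD -[in LHS]natr1 mulrDl mul1r.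
have [B B0 BP] := iter (Num.truncn (P / r)).
exists (B + 1) => [|t /andP[t0 tP]]; first by rewrite ltr_wpDl.
have : P / r < (Num.truncn (P / r)).+1%:R by exact: truncnS_gt.
set N := (Num.truncn (P / r)).+1 => NP.
have N0 : 0 < N%:R :> R by rewrite ltr0n.
have -> : t = N%:R * (t / N%:R) by rewrite mulrC divfK// gt_eqF.
apply: C11_le (BP _ _); first by rewrite lerDl.
rewrite ger0_norm ?divr_ge0 ?ler0n// ler_pdivrMr//.
by move: NP; rewrite ltr_pdivrMr// mulrC => /ltW; exact: le_trans.
Qed.

(* H commutes with the translation by P, so averaging the translates of H over
   the multiples of P / n yields the identity up to a constant and an error P / n. *)
Let mean_flow n y := n.+1%:R^-1 * \sum_(j < n.+1) flow (j%:R * (P / n.+1%:R)) y.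

Let mean_flow_G n y z :
  `|(mean_flow n y - mean_flow n z) - (G y - G z)| <= P / n.+1%:R.
Proof.
pose a := P / n.+1%:R; pose S x := n.+1%:R^-1 * \sum_(j < n.+1) H (x + j%:R * a).
have a0 : 0 < a by rewrite divr_gt0.
have n0 : n.+1%:R != 0 :> R by rewrite pnatr_eq0.
have S_le : {homo S : x y / x <= y}.
  move=> u v uv; rewrite ler_pM2l ?invr_gt0// ler_sum// => j _.
  by move: uv; rewrite le_eqVlt => /predU1P[->//|uv]; rewrite ltW// H_lt// ltrD2r.
(* The shift by [a] replaces the first term [H u] of the sum by [H (u + P) = H u + P], and [P]
   divided by the number of terms is [a]. *)
have Sa u : S (u + a) = S u + a.
  rewrite /S big_ord_recr big_ord_recl /= mul0r addr0.
  rewrite (_ : u + a + n%:R * a = u + P); last first.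
    by rewrite /a -natr1; field; rewrite natr1.
  rewrite HP (_ : \sum_(i < n) _ = \sum_(i < n) H (u + (lift ord0 i)%:R * a)).
    by rewrite !mulrDr [_ * P]mulrC addrA (addrC (_ * \sum_(_ < _) _)).
  by apply: eq_bigr => i _; rewrite -addrA lift0 -natr1 mulrDl mul1r (addrC a).
have Sm m u : S (u + m%:R * a) = S u + m%:R * a.
  elim: m => [|m IH]; first by rewrite mul0r !addr0.
  by rewrite -natr1 mulrDl mul1r !addrA Sa IH.
(* [S] is monotone and grows by exactly [m * a] from [u] to [u + m * a], which pins its increments
   up to [a]. *)
have key u v : u <= v -> `|(S v - S u) - (v - u)| <= a.
  move=> uv; have q0 : 0 <= (v - u) / a by rewrite divr_ge0 ?subr_ge0// ltW.
  have /andP[] := truncn_itv q0; set m := Num.truncn _.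
  rewrite ler_pdivlMr// ltr_pdivrMr// => m1 m2.
  have /S_le : u + m%:R * a <= v by lra.
  have /S_le : v <= u + m.+1%:R * a by lra.
  rewrite !Sm => A B; move: m2 A; rewrite -natr1 mulrDl mul1r => m2 A.
  by rewrite ler_norml; apply/andP; split; lra.
have SE x : mean_flow n x = S (G x) by [].
rewrite !SE; have [/key//|/ltW/key] := leP (G z) (G y).
by rewrite -[X in X <= _ -> _]normrN; congr (`|_| <= _); ring.
Qed.

Let le_mean n (C : R) (u : 'I_n.+1 -> R) : (forall j, `|u j| <= C) ->
  `|n.+1%:R^-1 * \sum_j u j| <= C.
Proof.
move=> uC; rewrite normrM gtr0_norm ?invr_gt0 ?ltr0n// mulrC ler_pdivrMr ?ltr0n//.
apply: le_trans (ler_norm_sum _ _ _) _; apply: le_trans (ler_sum _ (fun j _ => uC j)) _.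
by rewrite sumr_const card_ord mulr_natr.
Qed.

Let ge_mean n (C : R) (u : 'I_n.+1 -> R) : (forall j, C <= u j) ->
  C <= n.+1%:R^-1 * \sum_j u j.
Proof.
move=> uC; rewrite mulrC ler_pdivlMr ?ltr0n//.
apply: le_trans (ler_sum _ (fun j _ => uC j)).
by rewrite sumr_const card_ord mulr_natr.
Qed.

Let le_lim (x y C : R) : 0 <= C -> (forall n : nat, x <= y + C / n.+1%:R) -> x <= y.
Proof.
move=> C0 xy; rewrite leNgt; apply/negP => yx; have d0 : 0 < x - y by rewrite subr_gt0.
have := xy (Num.truncn (C / (x - y))); have := truncnS_gt (C / (x - y)).
set n := (Num.truncn _).+1; have n0 : 0 < n%:R :> R by rewrite ltr0n.
by rewrite ltr_pdivrMr// mulrC -ltr_pdivrMr//; lra.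
Qed.

Let step_in_period n (j : 'I_n.+1) : 0 <= j%:R * (P / n.+1%:R) <= P.
Proof.
have n0 : 0 < n.+1%:R :> R by rewrite ltr0n.
rewrite mulr_ge0 ?divr_ge0 ?ler0n ?(ltW P0)//= mulrA ler_pdivrMr// mulrC.
by rewrite ler_wpM2l ?(ltW P0)// ler_nat ltnW.
Qed.

Let mean_sub n y z : mean_flow n y - mean_flow n z = n.+1%:R^-1 *
  \sum_(j < n.+1) (flow (j%:R * (P / n.+1%:R)) y - flow (j%:R * (P / n.+1%:R)) z).
Proof. by rewrite /mean_flow -mulrBr sumrB. Qed.

(** Bounds uniform in [t] pass to the means of the flow, and from these to [G] in the limit. The
    lower bound holds because [flow (P - t)] inverts [flow t] up to the translation by [P] and is
    [A]-Lipschitz. *)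
Let G_C11 : exists2 A, 0 < A &
  C11 A G /\ forall s y, 0 < s -> A^-1 <= diff_quot G s y.
Proof.
have [A A0 AP] := flow_unif_C11; exists A => //.
have close y s n : 0 < s -> `|diff_quot G s y - diff_quot (mean_flow n) s y| <= P / s / n.+1%:R.
  move=> s0; rewrite /diff_quot -mulrBl normrM normrV ?unitfE ?gt_eqF// (gtr0_norm s0).
  by rewrite mulrAC ler_wpM2r ?invr_ge0 ?(ltW s0)// distrC mean_flow_G.
have meanq n s y : diff_quot (mean_flow n) s y = n.+1%:R^-1 *
    \sum_(j < n.+1) diff_quot (flow (j%:R * (P / n.+1%:R))) s y.
  by rewrite /diff_quot mean_sub -mulrA; congr (_ * _); rewrite mulr_suml.
split; first split.
- move=> y z; apply: (le_lim (ltW P0)) => n; have := mean_flow_G n y z.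
  have : `|mean_flow n y - mean_flow n z| <= A * `|y - z|.
    by rewrite mean_sub; apply: le_mean => j; apply: (AP _ (step_in_period j)).1.
  move=> a; rewrite distrC => b; rewrite -[X in `|X|](subrK (mean_flow n y - mean_flow n z)).
  by rewrite (le_trans (ler_normD _ _))// addrC lerD.
- move=> y s s' s0 s'0; apply: (@le_lim _ _ (P / s + P / s')) => [|n].
    by rewrite addr_ge0 ?divr_ge0 ?(ltW P0) ?(ltW s0) ?(ltW s'0).
  have : `|diff_quot (mean_flow n) s y - diff_quot (mean_flow n) s' y| <= A * (s + s').
    rewrite !meanq -mulrBr -sumrB; apply: le_mean => j.
    exact: (AP _ (step_in_period j)).2.
  have := close y s' n s'0; have := close y s n s0.
  rewrite [(P / s + _) / _]mulrDl; set p := P / s / _; set p' := P / s' / _.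
  set q1 := diff_quot G s y; set q2 := diff_quot G s' y.
  set q3 := diff_quot _ s y; set q4 := diff_quot _ s' y; set K := A * _.
  rewrite !ler_norml => /andP[? ?] /andP[? ?] /andP[? ?].
  by apply/andP; split; lra.
- move=> s y s0; apply: (@le_lim _ _ (P / s)) => [|n].
    by rewrite divr_ge0 ?(ltW P0) ?(ltW s0).
  suff : A^-1 <= diff_quot (mean_flow n) s y.
    have := close y s n s0; set p := P / s / _; set q1 := diff_quot _ s y; set q2 := diff_quot _ s y.
    by set K := A^-1; rewrite ler_norml => /andP[]; lra.
  rewrite meanq; apply: ge_mean => j; have := step_in_period j.
  set t := j%:R * _ => tP; rewrite /diff_quot ler_pdivlMr// mulrC ler_pdivrMr//.
  have /AP[+ _] : 0 <= P - t <= P by move: tP => /andP[? ?]; apply/andP; split; lra.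
  move=> /(_ (flow t (y + s)) (flow t y)); rewrite !flowD (addrC t) subrK.
  have flowPE z : flow P z = z + P by rewrite /flow HP GK.
  rewrite !flowPE.
  rewrite (_ : y + s + P - (y + P) = s); last by ring.
  by rewrite !gtr0_norm ?subr_gt0 ?flow_lt ?ltrDl// mulrC.
Qed.

Lemma conj_Ck1 : Ck 1 H /\ forall x, 0 < derive1 H x.
Proof.
have [A A0 [[Gl Gq] Glow]] := G_C11.
have Gc : continuous G.
  move=> x; apply/continuous_eps => e e0; exists (e / A); first by rewrite divr_gt0.
  by move=> y yx; apply: le_lt_trans (Gl y x) _; rewrite mulrC -ltr_pdivlMr.
have G1 : Ck 1 G.
  apply: unif_quot_Ck1 => // e e0; exists (e / (2 * A)).
    by rewrite divr_gt0// mulr_gt0.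
  move=> x s s' /andP[s0 se] /andP[s'0 s'e]; apply: le_trans (Gq x s s' s0 s'0) _.
  rewrite mulrC -ler_pdivlMr//.
  have -> : e / A = e / (2 * A) + e / (2 * A) by field; rewrite gt_eqF.
  by rewrite lerD.
have [_ Gd] := CkS_derive G1.
(* The quotients are at least [A^-1], and approximate the derivative to within half of that. *)
have G'0 x : 0 < derive1 G x.
  have e0 : 0 < A^-1 / 2 by rewrite divr_gt0// invr_gt0.
  have [d d0 dP] := derive_eps (Gd x) e0.
  have d2 : 0 < d / 2 by rewrite divr_gt0.
  have := dP (d / 2); rewrite gt_eqF// gtr0_norm// => /(_ isT).
  have -> : d / 2 < d by lra.
  by move=> /(_ isT); have := Glow (d / 2) x d2; rewrite /diff_quot ler_norml => ? /andP[]; lra.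
have H1 : Ck 1 H by apply: (Ck_inverse GK HK G1) => x; rewrite gt_eqF.
split=> // x; have [_ Hd] := CkS_derive H1.
have D := @is_derive1_comp R G H x _ _ (Gd (H x)) (Hd x).
have E : G \o H = id by apply/funext => y /=; rewrite HK.
rewrite E in D; have := @derive_val _ _ _ _ _ _ _ D.
rewrite (@derive_val _ _ _ _ _ _ _ (is_derive_id x (1 : R))) => e1.
by rewrite -(pmulr_rgt0 _ (G'0 (H x))) -e1 ltr01.
Qed.

End FlowC2.

(** Bootstrapping: when [H] is of class C^(j+1), [u = ln H'] is of class C^j, but its differences
    are [ln (flow t)'] composed with [H], of class C^(j+1). The difference property raises [u] to
    that class, and [H] by one degree with it. *)
Lemma conj_Ck k : (forall t, Ck k.+2 (fun y => H (G y + t))) -> Ck k.+2 H /\ Ck k.+2 G.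
Proof.
move=> flowk; have [|H1 H'0] := conj_Ck1; first by move=> t; exact: CkW_le (flowk t).
suff Hk : Ck k.+2 H.
  split; first exact: Hk.
  by apply: (Ck_inverse HK GK Hk) => x; rewrite gt_eqF.
suff C j : (j <= k.+1)%N -> Ck j.+1 H by exact: C.
elim: j => [_|j IH jk]; first exact: H1.
 have Hj := IH (ltnW jk); have [H'j Hd] := CkS_derive Hj.
pose u x := ln (derive1 H x).
have uE : derive1 H = expR \o u.
  by apply/funext => x; rewrite /u/= lnK// posrE.
suff uj : Ck j.+1 u.
  by apply: (CkS_is_derive Hd); rewrite uE; exact: (Ck_comp (Ck_expR R j.+1) uj).
apply: (@difference_property_Ck _ P P0).
- exact: (Ck_ln H'0 H'j).
- move=> x; rewrite /u; congr ln; apply: equivariant_derive1; first exact: HP.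
  by move=> y; exact: ex_derive.
move=> t; have [f'k fd] := CkS_derive (flowk t).
(* The chain rule on both sides of [flow t (H x) = H (x + t)]. *)
have H't x : derive1 H (x + t) = derive1 (flow t) (H x) * derive1 H x.
  have S : is_derive x (1 : R) (fun y => y + t) 1.
    by have := is_deriveD (is_derive_id x (1 : R)) (is_derive_cst t x 1); rewrite addr0.
  have A := @is_derive1_comp R H (fun y => y + t) x _ _ (Hd (x + t)) S.
  have B := @is_derive1_comp R (flow t) H x _ _ (fd (H x)) (Hd x).
  have E : flow t \o H = H \o (fun y => y + t) by apply/funext => y; rewrite /flow/= HK.
  rewrite E in B; rewrite -(@derive_val _ _ _ _ _ _ _ B).
  by rewrite (@derive_val _ _ _ _ _ _ _ A) mulr1.
have f'0 y : 0 < derive1 (flow t) y.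
  by have := H'0 (G y + t); rewrite H't GK pmulr_lgt0.
rewrite (_ : (fun x => _) = (fun y => ln (derive1 (flow t) y)) \o H).
  exact: (Ck_comp (Ck_ln f'0 (CkW_le jk f'k)) Hj).
by apply/funext => x; rewrite /u/= H't lnM ?posrE// addrK.
Qed.

End Conjugacy.

(** * Lifts of circle homeomorphisms *)

Section CircleLifts.
Variable R : realType.
Local Notation tau := (tau R).
Local Notation S1 := (S1 R).

Lemma tau_gt0 : 0 < tau. Proof. by rewrite pmulrn_lgt0// pi_gt0. Qed.

Lemma circle_exp_int (k : int) t : circle_exp (t + tau * k%:~R) = circle_exp t :> S1.
Proof.
apply: S1_inj; rewrite ?crdx_exp ?crdy_exp; apply: periodic_int => x.
  exact: cosD2pi.
exact: sinD2pi.
Qed.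

(** Modulo [tau] the difference is some [r] in [[0, tau)] of cosine 1. Injectivity of the cosine on
    [[0, pi]] applies to [r], or else to [tau - r], where it contradicts [r < tau]. *)
Lemma circle_exp_eq (s t : R) : circle_exp s = circle_exp t ->
  exists k : int, s = t + tau * k%:~R.
Proof.
move=> st; have [k /andP[r0 rP]] := shift_in_period (s - t) tau_gt0.
exists k; set r := s - t - _ in r0 rP; suff : r = 0 by rewrite /r; lra.
have cr : cos r = 1.
  have -> : cos r = cos (s - t).
    rewrite -[in RHS](subrK (tau * k%:~R) (s - t)) -/r.
    exact/esym/(periodic_int k r (@cosD2pi R)).
  by rewrite cosB -!crdx_exp -!crdy_exp st -!expr2 S1P.
have [rpi|pir] := leP r pi.
  by apply: cos_inj; rewrite ?in_itv/= ?r0 ?rpi ?lexx ?pi_ge0// cr cos0.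
have : tau - r = 0.
  apply: cos_inj; rewrite ?in_itv/= ?lexx ?pi_ge0//.
    by apply/andP; split; have := @pi_gt0 R; lra.
  by rewrite cosB cos2pi sin2pi mul0r addr0 mul1r cr cos0.
lra.
Qed.

Lemma tau_int_between (j k : int) : ~ (tau * j%:~R < tau * k%:~R < tau * (j + 1)%:~R).
Proof. by rewrite !ltr_pM2l ?tau_gt0// !ltr_int; lia. Qed.

(** Two distinct values would force the intermediate value lying [tau / 2] above the smaller one,
    which is no multiple of [tau]. *)
Lemma tau_int_valued_cst (f : R -> R) a b : a <= b -> {in `[a, b], continuous f} ->
  (forall x, a <= x <= b -> exists k : int, f x = tau * k%:~R) -> f a = f b.
Proof.
move=> ab fc fk.
have [k ka] : exists k : int, f a = tau * k%:~R by apply: fk; rewrite lexx ab.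
have [l lb] : exists k : int, f b = tau * k%:~R by apply: fk; rewrite lexx ab.
have t0 := tau_gt0.
have novalue v : Num.min (f a) (f b) <= v <= Num.max (f a) (f b) ->
    exists j : int, v = tau * j%:~R.
  move=> vab; have [||c cab <-] := @IVT _ f a b v ab => //.
    by apply: continuous_in_subspaceT => x /set_mem; exact: fc.
  by apply: fk; move: cab; rewrite in_itv.
have sep (i j : int) : (i < j)%R -> tau * i%:~R + tau <= tau * j%:~R.
  by rewrite -lezD1 -(ler_int R) -(ler_pM2l t0) intrD mulrDr mulr1.
have [kl|lk|kl] := ltgtP k l; last by rewrite ka lb kl.
  have [|j jE] := novalue (tau * k%:~R + tau / 2).
    by have := sep _ _ kl; rewrite ka lb ge_min le_max => ?; apply/andP; split; apply/orP; [left|right]; lra.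
  by case: (@tau_int_between k j); rewrite -jE intrD mulrDr mulr1; apply/andP; split; lra.
have [|j jE] := novalue (tau * l%:~R + tau / 2).
  by have := sep _ _ lk; rewrite ka lb ge_min le_max => ?; apply/andP; split; apply/orP; [right|left]; lra.
by case: (@tau_int_between l j); rewrite -jE intrD mulrDr mulr1; apply/andP; split; lra.
Qed.

Lemma lift_unique (F G : R -> R) : continuous F -> continuous G ->
  (forall t, circle_exp (F t) = circle_exp (G t)) ->
  exists k : int, forall t, F t = G t + tau * k%:~R.
Proof.
move=> Fc Gc FG; have [k kE] := circle_exp_eq (FG 0); exists k => t.
suff : F t - G t = F 0 - G 0 by move: kE; lra.
have dc : continuous (fun t => F t - G t) by move=> x; apply: cvgB; [exact: Fc|exact: Gc].
have dk x : exists k : int, F x - G x = tau * k%:~R.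
  by have [l ->] := circle_exp_eq (FG x); exists l; rewrite addrC addKr.
have [t0|/ltW t0] := leP t 0.
  by apply: (@tau_int_valued_cst (fun t => F t - G t)).
by apply/esym; apply: (@tau_int_valued_cst (fun t => F t - G t)).
Qed.

(** The derivative of an angle is [cos F * (sin F)' - sin F * (cos F)']. Near [t], [F] coincides
    with the local lift through [F t], from which it differs by a multiple of [tau] smaller than
    [tau]. *)
Lemma Ck_lift k (F : R -> R) : continuous F ->
  Ck k (fun t => cos (F t)) -> Ck k (fun t => sin (F t)) -> Ck k F.
Proof.
move=> Fc; elim: k => [|k IH] ck sk; first exact/Ck0.
have [ck' cd] := CkS_derive ck; have [sk' sd] := CkS_derive sk.
pose f' t := cos (F t) * derive1 (fun t => sin (F t)) t -
  sin (F t) * derive1 (fun t => cos (F t)) t.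
apply: (@CkS_is_derive _ _ _ f'); last first.
  exact: (CkB (CkM (CkW ck) sk') (CkM (CkW sk) ck')).
move=> t; have [th [th0 thF thc thd]] := @local_lift R (fun t => circle_exp (F t)) t (F t)
  (Ck_cont ck (x := t)) (Ck_cont sk (x := t)) erefl.
apply: near_eq_is_derive (thd _ _ (cd t) (sd t)).
have dc : {for t, continuous (fun s => th s - F s)} by apply: cvgB => //; exact: Fc.
have [d d0 dP] := (continuous_eps _ _).1 dc _ tau_gt0.
apply: filterS2 thF ((nbhs_ballP _ _).2 (ex_intro2 _ _ d d0 (fun y => id))) => s.
rewrite /ball/= distrC => /circle_exp_eq[j jE] /dP; rewrite th0 subrr subr0.
rewrite jE addrC addKr normrM gtr0_norm ?tau_gt0// gtr_pMr ?tau_gt0//.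
rewrite -intr_norm -[1]/(1%:~R) ltr_int => j1.
have -> : j = 0 by move: j1; lia.
by rewrite mulr0 addr0.
Qed.

(** * Lifting of paths to the line *)

Section PathLifting.
Variables (G : R -> S1) (th0 : R).
Hypothesis xc : continuous (@crdx R \o G).
Hypothesis yc : continuous (@crdy R \o G).
Hypothesis th0E : circle_exp th0 = G 0.

(** [dot] and [crs] are the cosine and the sine of the angle from [G s] to [G t]. *)
Let dot s t := crdx (G s) * crdx (G t) + crdy (G s) * crdy (G t).
Let crs s t := crdx (G s) * crdy (G t) - crdy (G s) * crdx (G t).

Let dot_crs s t : dot s t ^+ 2 + crs s t ^+ 2 = 1.
Proof.
transitivity ((crdx (G s) ^+ 2 + crdy (G s) ^+ 2) * (crdx (G t) ^+ 2 + crdy (G t) ^+ 2)).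
  by rewrite /dot /crs; ring.
by rewrite !S1P mulr1.
Qed.

Let crs_itv s t : 0 < dot s t -> -1 < crs s t < 1.
Proof. by move=> d0; have := dot_crs s t; apply: contraPT; rewrite negb_and -!leNgt => /orP[] ?; nra. Qed.

Let step th s t : circle_exp th = G s -> 0 < dot s t ->
  circle_exp (th + asin (crs s t)) = G t.
Proof.
move=> thE d0; have /andP[c1 c2] := crs_itv d0.
have c : -1 <= crs s t <= 1 by rewrite !ltW.
have sa : sin (asin (crs s t)) = crs s t by rewrite asinK// in_itv.
have ca : cos (asin (crs s t)) = dot s t.
  by rewrite cos_asin// -(dot_crs s t) addrK sqrtr_sqr gtr0_norm.
have cE : cos th = crdx (G s) by rewrite -thE.
have sE : sin th = crdy (G s) by rewrite -thE.
apply: S1_inj; rewrite ?crdx_exp ?crdy_exp ?cosD ?sinD sa ca cE sE /dot /crs.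
  transitivity ((crdx (G s) ^+ 2 + crdy (G s) ^+ 2) * crdx (G t)); first by ring.
  by rewrite S1P mul1r.
transitivity ((crdx (G s) ^+ 2 + crdy (G s) ^+ 2) * crdy (G t)); first by ring.
by rewrite S1P mul1r.
Qed.

(** The angles of [G] between consecutive points [j * t / n] are summed; these points move
    continuously with [t], hence so does the sum. Uniform continuity gives an [n] valid for all [t]
    that keeps each angle acute, where [asin] recovers it. *)
Let local_path_lift T : 0 < T -> exists F : R -> R, [/\ F 0 = th0,
  (forall t, `|t| < T -> {for t, continuous F}) &
  (forall t, `|t| < T -> circle_exp (F t) = G t)].
Proof.
move=> T0; have e0 : 0 < 4^-1 :> R by rewrite invr_gt0 ltr0n.
have [d1 d10 d1P] := unif_cont_segment (- T) T xc e0.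
have [d2 d20 d2P] := unif_cont_segment (- T) T yc e0.
pose d := Num.min d1 d2; have d0 : 0 < d by rewrite lt_min d10.
pose n := (Num.truncn (T / d)).+1.
have n0 : 0 < n%:R :> R by rewrite ltr0n.
have nd : T / n%:R < d.
  by rewrite ltr_pdivrMr// mulrC -ltr_pdivrMr//; exact: truncnS_gt.
pose a j (t : R) := j%:R * (t / n%:R).
have dot0 (j : nat) t : (j < n)%N -> `|t| < T -> 0 < dot (a j t) (a j.+1 t).
  move=> jn tT.
  have aT : - T <= a j t <= T.
    rewrite -ler_norml /a normrM normrM normrV ?unitfE ?gt_eqF//.
    rewrite (ger0_norm (ler0n _ j)) (gtr0_norm n0) mulrA ler_pdivrMr// mulrC.
    by apply: ler_pM; rewrite ?normr_ge0 ?ler0n ?ler_nat ?(ltW tT) ?(ltnW jn).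
  have ad : `|a j.+1 t - a j t| < d.
    rewrite /a -natr1 mulrDl mul1r addrC addKr normrM normrV ?unitfE ?gt_eqF//.
    rewrite (gtr0_norm n0); apply: le_lt_trans nd.
    by rewrite ler_wpM2r ?invr_ge0 ?ltW.
  move: ad; rewrite lt_min => /andP[/(d1P _ _ aT) + /(d2P _ _ aT)] /=.
  rewrite /dot !ltr_norml => /andP[A1 A2] /andP[B1 B2].
  have := S1P (G (a j t)); have := S1P (G (a j.+1 t)).
  move: A1 A2 B1 B2; set x := crdx _; set x' := crdx _; set y := crdy _; set y' := crdy _.
  by move=> *; nra.
pose F m t := th0 + \sum_(j < m) asin (crs (a j t) (a j.+1 t)).
have FS m t : F m.+1 t = F m t + asin (crs (a m t) (a m.+1 t)).
  by rewrite /F big_ord_recr addrA.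
have a0 j : a j 0 = 0 by rewrite /a mul0r mulr0.
have ac j : continuous (a j).
  move=> t; apply: cvgM; first exact: cvg_cst.
  by apply: cvgM; [exact: cvg_id|exact: cvg_cst].
exists (F n); split.
- rewrite /F big1 ?addr0// => j _; rewrite !a0 /crs mulrC subrr.
  exact: asin0.
- move=> t tT; have : (n <= n)%N by []; move: {-2}n => m.
  elim: m => [_|m IH mn].
    rewrite (_ : F 0%N = cst th0); first exact: cvg_cst.
    by apply/funext => u; rewrite /F big_ord0 addr0.
  rewrite (_ : F m.+1 = F m \+ (fun t => asin (crs (a m t) (a m.+1 t)))); last exact/funext.
  apply: cvgD; first by apply: IH; exact: ltnW.
  apply: (@continuous_comp _ _ _ (fun t => crs (a m t) (a m.+1 t)) asin); last first.
    exact/continuous_asin/crs_itv/dot0.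
  apply: cvgB; apply: cvgM.
  + by apply: (@continuous_comp _ _ _ (a m) (@crdx R \o G)); [exact: ac|exact: xc].
  + by apply: (@continuous_comp _ _ _ (a m.+1) (@crdy R \o G)); [exact: ac|exact: yc].
  + by apply: (@continuous_comp _ _ _ (a m) (@crdy R \o G)); [exact: ac|exact: yc].
  + by apply: (@continuous_comp _ _ _ (a m.+1) (@crdx R \o G)); [exact: ac|exact: xc].
- move=> t tT; have {2}-> : t = a n t by rewrite /a mulrC divfK// gt_eqF.
  have : (n <= n)%N by []; move: {-2}n => m.
  elim: m => [_|m IH mn]; first by rewrite /F big_ord0 addr0 /a mul0r.
  by rewrite FS; apply: step; [exact: IH (ltnW mn)|exact: dot0].
Qed.

(** The lifts over growing intervals have the same value at 0, so they agree where both are defined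
    and glue together. *)
Lemma path_lift : exists2 F : R -> R, continuous F & forall t, circle_exp (F t) = G t.
Proof.
have [Fs FsP] := choice (fun n : nat => local_path_lift (ltr0Sn R n)).
have agree m n t : `|t| < m.+1%:R -> `|t| < n.+1%:R -> Fs m t = Fs n t.
  move=> tm tn; have [m0 mc mE] := FsP m; have [n0 nc nE] := FsP n.
  apply/eqP; rewrite -subr_eq0.
  have <- : Fs m 0 - Fs n 0 = 0 by rewrite m0 n0 subrr.
  have dc s : `|s| <= `|t| -> {for s, continuous (fun t => Fs m t - Fs n t)}.
    by move=> st; apply: cvgB; [apply: mc|apply: nc]; exact: le_lt_trans st _.
  have dk s : `|s| <= `|t| -> exists k : int, Fs m s - Fs n s = tau * k%:~R.
    move=> st; have [|k ->] := @circle_exp_eq (Fs m s) (Fs n s).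
      by rewrite mE ?nE//; exact: le_lt_trans st _.
    by exists k; rewrite addrC addKr.
  have [t0|/ltW t0] := leP t 0; [|rewrite eq_sym]; apply/eqP;
    apply: (@tau_int_valued_cst (fun t => Fs m t - Fs n t)) => // s; rewrite ?in_itv/= => /andP[? ?].
  - by apply: dc; rewrite !ler0_norm//; lra.
  - by apply: dk; rewrite !ler0_norm//; lra.
  - by apply: dc; rewrite !ger0_norm//; lra.
  - by apply: dk; rewrite !ger0_norm//; lra.
pose F t := Fs (Num.truncn `|t|) t.
have FE n t : `|t| < n.+1%:R -> F t = Fs n t.
  by move=> tn; apply: agree => //; exact: truncnS_gt.
exists F => [t|t]; last by have [_ _ ->] := FsP (Num.truncn `|t|) => //; exact: truncnS_gt.
set n := Num.truncn `|t|; have tn : `|t| < n.+1%:R by exact: truncnS_gt.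
have [_ nc _] := FsP n; apply/continuous_eps => e e0.
have [d d0 dP] := (continuous_eps _ _).1 (nc t tn) _ e0.
exists (Num.min d (n.+1%:R - `|t|)); first by rewrite lt_min d0 subr_gt0.
move=> y; rewrite lt_min => /andP[yd yn].
rewrite !(FE n)//; first exact: dP.
rewrite -(subrK t y) (le_lt_trans (ler_normD _ _))//.
by move: yn; lra.
Qed.

End PathLifting.

End CircleLifts.

(** * Increasing lifts and their fixed points *)

Section IncLift.
Variable R : realType.
Local Notation tau := (tau R).
Local Notation S1 := (S1 R).
Implicit Types (F G : R -> R) (f g : S1 -> S1).

Definition inc_lift F f := [/\ continuous F, {homo F : x y / x < y},
  (forall t, F (t + tau) = F t + tau) & forall t, circle_exp (F t) = f (circle_exp t)].

Lemma inc_lift_le F f : inc_lift F f -> {homo F : x y / x <= y}.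
Proof. by case=> _ F_lt _ _; exact: ltW_homo. Qed.

Lemma inc_lift_inj F f : inc_lift F f -> injective F.
Proof.
by case=> _ F_lt _ _ x y xy; have [/F_lt|/F_lt|//] := ltgtP x y; rewrite xy ltxx.
Qed.

Lemma inc_lift_int F f : inc_lift F f -> forall (k : int) t, F (t + tau * k%:~R) = F t + tau * k%:~R.
Proof.
case=> _ _ FP _ k t; suff : F (t + tau * k%:~R) - (t + tau * k%:~R) = F t - t by lra.
by apply: (@periodic_int _ tau (fun t => F t - t)) => x; rewrite /= FP; ring.
Qed.

Lemma inc_lift_shift F f (k : int) : inc_lift F f -> inc_lift (fun t => F t + tau * k%:~R) f.
Proof.
case=> Fc F_lt FP FE; split.
- by move=> t; apply: cvgD; [exact: Fc|exact: cvg_cst].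
- by move=> x y xy; rewrite ltrD2r F_lt.
- by move=> t; rewrite FP addrAC.
- by move=> t; rewrite circle_exp_int.
Qed.

Lemma inc_lift_comp F f G g : inc_lift F f -> inc_lift G g -> inc_lift (F \o G) (f \o g).
Proof.
case=> Fc F_lt FP FE [Gc G_lt GP GE]; split.
- by move=> t; apply: continuous_comp; [exact: Gc|exact: Fc].
- by move=> x y xy; exact/F_lt/G_lt.
- by move=> t /=; rewrite GP FP.
- by move=> t /=; rewrite FE GE.
Qed.

Lemma inc_lift_ext F f g : f =1 g -> inc_lift F f -> inc_lift F g.
Proof. by move=> fg [? ? ? FE]; split=> // t; rewrite FE fg. Qed.

Lemma inc_lift_id : inc_lift id id.
Proof. by split=> // t; exact: cvg_id. Qed.

Lemma inc_lift_unique F G f : inc_lift F f -> inc_lift G f ->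
  exists k : int, forall t, F t = G t + tau * k%:~R.
Proof. by case=> Fc _ _ FE [Gc _ _ GE]; apply: lift_unique => // t; rewrite FE GE. Qed.

(** [F] moves by some [tau * m] over a period. The point sent to [F 0 + tau] represents the same
    circle point as 0, so it is some [tau * j], whence [m * j = 1]; as [F] increases, [m = 1]. *)
Lemma increasing_equivariant F G : continuous F -> {homo F : x y / x < y} ->
  cancel G F ->
  (forall s t, circle_exp s = circle_exp t <-> circle_exp (F s) = circle_exp (F t) :> S1) ->
  forall t, F (t + tau) = F t + tau.
Proof.
move=> Fc F_lt GK FE; have t0 := tau_gt0 R.
have expP t : circle_exp (t + tau) = circle_exp t :> S1.
  by have := circle_exp_int 1 t; rewrite mulr1.
have [|t|m mE] := @lift_unique R (fun t => F (t + tau)) F _ Fc.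
- move=> t; apply: (@continuous_comp _ _ _ (fun t => t + tau) F); last exact: Fc.
  by apply: cvgD; [exact: cvg_id|exact: cvg_cst].
- by apply: (FE _ _).1; exact: expP.
have FI (j : int) : F (0 + tau * j%:~R) = F 0 + tau * (m * j)%:~R.
  suff : F (0 + tau * j%:~R) - (0 + tau * j%:~R) * m%:~R = F 0 - 0 * m%:~R.
    by rewrite intrM; lra.
  by apply: (@periodic_int _ tau (fun t => F t - t * m%:~R)) => x; rewrite /= mE; ring.
have [|j jE] := @circle_exp_eq R (G (F 0 + tau)) 0.
  by apply: (FE _ _).2; rewrite GK expP.
have mj : (m * j = 1)%R.
  apply/(@intr_inj R)/(mulfI (lt0r_neq0 t0)); move: (FI j); rewrite -jE GK; lra.
have m0 : (0 < m)%R.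
  have := F_lt 0 (0 + tau); rewrite mE ltrDl ltrDl t0 => /(_ isT).
  by rewrite pmulr_rgt0// ltr0z.
have j0 : (0 < j)%R by rewrite -(pmulr_rgt0 _ m0) mj.
have m1 : m = 1 by clear -mj m0 j0; nia.
by move=> t; rewrite mE m1 mulr1.
Qed.

Lemma circle_exp_oppE s t : circle_exp (- s) = circle_exp (- t) :> S1 <->
  circle_exp s = circle_exp t :> S1.
Proof.
split=> st; apply: S1_inj; move: (congr1 (@crdx R) st) (congr1 (@crdy R) st);
  rewrite !crdx_exp !crdy_exp ?cosN ?sinN//; last by move=> _ ->.
by move=> _ /oppr_inj.
Qed.

Lemma fixpoint_trap F f y : inc_lift F f -> F y = y -> forall t, exists z,
  [/\ z <= t < z + tau, F z = z & forall s, z <= s < z + tau -> z <= F s < z + tau].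
Proof.
move=> Ff Fy t; have [k /andP[k0 k1]] := shift_in_period (t - y) (tau_gt0 R).
exists (y + tau * k%:~R); have Fz : F (y + tau * k%:~R) = y + tau * k%:~R.
  by rewrite (inc_lift_int Ff) Fy.
split=> // [|s /andP[s1 s2]]; first by apply/andP; split; lra.
rewrite -{1}Fz (inc_lift_le Ff)//=; case: Ff => _ F_lt FP _.
by rewrite -{1}Fz -FP F_lt.
Qed.

Lemma fixpoint_displacement F f y t : inc_lift F f -> F y = y -> `|F t - t| < tau.
Proof.
move=> Ff Fy; have [z [zt _ /(_ t zt) zF]] := fixpoint_trap Ff Fy t.
by move: zt zF => /andP[? ?] /andP[? ?]; rewrite ltr_norml; apply/andP; split; lra.
Qed.

(* f ^ (2 ^ j) is conjugate to f, so suitable lifts have the same displacement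
   bound, whereas the iterates of a fixed point free lift are unbounded. *)
Lemma conj_square_fixpoint F f K k : inc_lift F f -> inc_lift K k ->
  (exists L, cancel L K) -> f \o f \o k =1 k \o f ->
  exists2 F', inc_lift F' f & exists y, F' y = y.
Proof.
move=> Ff Kk [L LK] ffk; have t0 := tau_gt0 R.
have FFK := inc_lift_comp (inc_lift_comp Ff Ff) Kk.
have [m mE] := inc_lift_unique (inc_lift_ext ffk FFK) (inc_lift_comp Kk Ff).
(* [F] occurs twice on one side of the relation and once on the other, so a shift of [F] absorbs the
   ambiguity [m]. *)
pose F1 t := F t + tau * (- m)%:~R.
have F1f : inc_lift F1 f by exact: inc_lift_shift.
exists F1 => //; have rel t : F1 (F1 (K t)) = K (F1 t).
  rewrite /F1 (inc_lift_int Ff) (inc_lift_int Kk).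
  by move: (mE t) => /= ->; rewrite mulrNz; ring.
have [F1c F1_lt F1P _] := F1f.
have [M M0 MP] : exists2 M, 0 < M & forall t, `|F1 t - t| <= M.
  apply: (periodic_bounded t0) => t; last by rewrite F1P; ring.
  by apply: cvgB; [exact: F1c|exact: cvg_id].
(* The bound is a whole number of periods because [K] commutes with such translations. *)
pose C := (Num.truncn (M / tau)).+1; have CM : M <= tau * C%:R.
  by rewrite mulrC -ler_pdivrMr//; apply/ltW/truncnS_gt.
have relI n t : iter n.*2 F1 (K t) = K (iter n F1 t).
  by elim: n => //= n ->; rewrite rel.
have bound j s : `|iter (2 ^ j) F1 s - s| <= tau * C%:R.
  elim: j s => [|j IH] s; first by rewrite expn0 /=; exact: le_trans (MP s) CM.
  rewrite -(LK s) expnS mul2n relI.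
  have KC (n : int) x := inc_lift_int Kk n x.
  have := IH (L s); rewrite !ler_norml => /andP[a b].
  have /(inc_lift_le Kk) : L s + tau * (- C%:Z)%:~R <= iter (2 ^ j) F1 (L s).
    by rewrite mulrNz mulrN; move: a; rewrite pmulrn; lra.
  have /(inc_lift_le Kk) : iter (2 ^ j) F1 (L s) <= L s + tau * C%:Z%:~R.
    by move: b; rewrite pmulrn; lra.
  rewrite !KC mulrNz mulrN pmulrn => ? ?.
  by apply/andP; split; lra.
apply: contrapT => nofix.
have nofix' x : F1 x <> x by move=> Fx; apply: nofix; exists x.
(* Without a fixed point the orbit of 0 is monotone, so its term of index [n] is controlled by the
   one of index [2 ^ n]; being bounded, the orbit converges to a fixed point after all. *)
suff [l _ lE] : exists2 l, setT l & F1 l = l by exact: nofix' lE.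
apply: (@iter_cvg_fixpoint _ F1 setT 0 (tau * C%:R)) => //.
  exact: inc_lift_le F1f.
move=> n; have nn : (n <= 2 ^ n)%N by rewrite ltnW// ltn_expl.
have := bound n 0; rewrite subr0; apply: le_trans.
have [up|dn] := fixpoint_free_sign F1c nofix'.
  have mono : {homo (fun n => iter n F1 0) : n m / (n <= m)%N >-> n <= m}.
    by apply/nondecreasing_seqP => i /=; exact/ltW/up.
  by rewrite !ger0_norm ?mono//; [exact: (mono 0%N)|exact: (mono 0%N)].
have mono : {homo (fun n => iter n F1 0) : n m / (n <= m)%N >-> m <= n}.
  by apply/nonincreasing_seqP => i /=; exact/ltW/dn.
by rewrite !ler0_norm ?lerN2 ?mono//; [exact: (mono 0%N)|exact: (mono 0%N)].
Qed.

(** Passing to the square of [b] doubles the ambiguity [m] of the lifted relation, so that it splits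
    evenly and some lift [F] satisfies [F \o K \o F = K]. If [F] had no fixed point it would move
    all points in one direction, and both occurrences would push [K] that way. *)
Lemma conj_inverse_fixpoint B b K k : inc_lift B b -> inc_lift K k ->
  b \o k \o b =1 k -> exists2 F, inc_lift F (b \o b) & exists y, F y = y.
Proof.
move=> Bb Kk bkb.
have [m mE] := inc_lift_unique (inc_lift_ext bkb (inc_lift_comp (inc_lift_comp Bb Kk) Bb)) Kk.
pose F t := B (B t) + tau * (- m)%:~R.
have Ff : inc_lift F (b \o b) by exact: (inc_lift_shift _ (inc_lift_comp Bb Bb)).
exists F => //; have rel t : F (K (F t)) = K t.
  rewrite /F (inc_lift_int Kk) !(inc_lift_int Bb).
  move: (mE (B t)) (mE t) => /= ->; rewrite (inc_lift_int Bb) => ->.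
  by rewrite mulrNz; ring.
apply: contrapT => nofix.
have [Fc F_lt _ _] := Ff; have [_ K_lt _ _] := Kk.
have [|up|dn] := @fixpoint_free_sign _ F Fc.
- by move=> x Fx; apply: nofix; exists x.
- by have := lt_trans (K_lt _ _ (up 0)) (up (K (F 0))); rewrite rel ltxx.
- by have := lt_trans (dn (K (F 0))) (K_lt _ _ (dn 0)); rewrite rel ltxx.
Qed.

End IncLift.

(** * Lifts of elements of [Diff] and common fixed points *)

Section DiffLift.
Variables (R : realType) (p : regularity).
Local Notation tau := (tau R).
Local Notation S1 := (S1 R).
Implicit Types (F G : R -> R) (f g : Diff R p).

Lemma Creg_cont (u : R -> R) : Creg p u -> continuous u.
Proof. by case: p => [k|] uk; [exact: Ck_cont uk|exact: Ck_cont (uk 0%N)]. Qed.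

Lemma Cmap_lift (f : S1 -> S1) : Cmap p f ->
  exists2 F, continuous F & forall t, circle_exp (F t) = f (circle_exp t).
Proof.
case=> /Creg_cont xc /Creg_cont yc.
have [th0 th0E] := circle_exp_surj (f (circle_exp 0)).
exact: (@path_lift R (fun t => f (circle_exp t)) th0 xc yc th0E).
Qed.

Lemma diff_Cmap f : Cmap p (diff_fun f).
Proof. by case: (Defs.diffP f) => g []. Qed.

Lemma diff_inj f : injective (diff_fun f).
Proof. exact: can_inj (diff_invK f). Qed.

Lemma diff_lift f : exists F G, [/\ continuous F, continuous G, cancel F G, cancel G F &
  [/\ (forall t, circle_exp (F t) = f (circle_exp t)),
    (forall t, circle_exp (G t) = diff_inv f (circle_exp t)) &
  ({homo F : x y / x < y} /\ forall t, F (t + tau) = F t + tau) \/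
  ({homo (F \o -%R) : x y / x < y} /\ forall t, F (- (t + tau)) = F (- t) + tau)]].
Proof.
have [F Fc FE] := Cmap_lift (diff_Cmap f).
have [G0 G0c G0E] := Cmap_lift (diff_Cmap (diff_inv f)).
have [m mE] : exists m : int, forall t, G0 (F t) = t + tau * m%:~R.
  apply: lift_unique => [t|t|t]; last by rewrite G0E FE diff_invK.
    by apply: continuous_comp; [exact: Fc|exact: G0c].
  exact: cvg_id.
pose G t := G0 t - tau * m%:~R.
have Gc : continuous G by move=> t; apply: cvgB; [exact: G0c|exact: cvg_cst].
have GE t : circle_exp (G t) = diff_inv f (circle_exp t).
  by rewrite -G0E /G -mulrN -mulrNz circle_exp_int.
have FK : cancel F G by move=> t; rewrite /G mE addrK.
have [k kE] : exists k : int, forall t, F (G t) = t + tau * k%:~R.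
  apply: lift_unique => [t|t|t]; last by rewrite FE GE diff_invKr.
    by apply: continuous_comp; [exact: Gc|exact: Fc].
  exact: cvg_id.
have GK : cancel G F.
  move=> t; rewrite kE; suff -> : k = 0 by rewrite mulr0 addr0.
  have /eqP := kE (F 0); rewrite FK addrC -subr_eq subrr eq_sym mulf_eq0.
  by rewrite gt_eqF ?tau_gt0//= intr_eq0 => /eqP.
exists F, G; split=> //; split=> //.
have FI s t : circle_exp s = circle_exp t <-> circle_exp (F s) = circle_exp (F t).
  by rewrite !FE; split=> [->//|/diff_inj].
have [||incr|decr] := @itv_continuous_inj_mono _ F `]-oo, +oo[.
- exact/continuous_subspaceT.
- by move=> x y _ _; exact: (can_inj FK).
- have F_lt : {homo F : x y / x < y}.
    by move=> x y xy; rewrite incr ?in_itv.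
  left; split=> //; exact: (increasing_equivariant Fc F_lt GK FI).
have F_lt : {homo (F \o -%R) : x y / x < y}.
  by move=> x y xy /=; rewrite decr ?in_itv//= ltrN2.
right; split=> //; apply: (@increasing_equivariant _ _ (-%R \o G)) => //.
- by move=> t; apply: continuous_comp; [apply: cvgN; exact: cvg_id|exact: Fc].
- by move=> t /=; rewrite opprK GK.
- by move=> s t /=; rewrite -FI circle_exp_oppE.
Qed.

(** Reversing the orientation twice preserves it. *)
Lemma inc_lift_square f : exists F, inc_lift F (f * f)%g.
Proof.
have [F [G [Fc _ _ _ [FE _ [[F_lt FP]|[F_lt FP]]]]]] := diff_lift f.
  by exists (F \o F); apply: (@inc_lift_comp _ F f F f).
exists (F \o F); split.
- by move=> t; apply: continuous_comp; exact: Fc.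
- by move=> x y xy; have := F_lt (- F x) (- F y); rewrite /= !opprK ltrN2; apply;
    have := F_lt (- y) (- x); rewrite /= !opprK ltrN2; apply.
- have FB u : F (u - tau) = F u + tau.
    by have := FP (- u); rewrite opprD !opprK.
  by move=> t /=; rewrite -[in RHS](addrK tau t) FB -FB addrK.
- by move=> t /=; rewrite !FE.
Qed.

Lemma inc_lift_inv F f : inc_lift F f ->
  exists G, [/\ cancel F G, cancel G F & inc_lift G (f^-1)%g].
Proof.
move=> Ff; have [Fc F_lt FP FE] := Ff.
have [F0 [G0 [F0c G0c FK GK [F0E G0E _]]]] := diff_lift f.
have [k kE] : exists k : int, forall t, F t = F0 t + tau * k%:~R.
  by apply: lift_unique => // t; rewrite FE F0E.
exists (fun t => G0 (t - tau * k%:~R)).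
have FG : cancel F (fun t => G0 (t - tau * k%:~R)) by move=> t; rewrite kE addrK FK.
have GF : cancel (fun t => G0 (t - tau * k%:~R)) F by move=> t; rewrite kE GK subrK.
split=> //; split.
- move=> t; apply: (@continuous_comp _ _ _ (fun t => t - tau * k%:~R) G0); last exact: G0c.
  by apply: cvgB; [exact: cvg_id|exact: cvg_cst].
- move=> x y xy; rewrite -(leW_mono (le_mono F_lt)) ?GF//.
- by move=> t; apply: (can_inj FG); rewrite FP !GF.
- by move=> t; apply: (@diff_inj f); rewrite -FE GF diff_invKr.
Qed.

(* The lifts with a fixed point compose consistently, and the supremum of an
   orbit under them is fixed. *)
Lemma common_fixpoint (e : R -> Diff R p) (S : set R) :
  (forall x y, e (x + y) = e x * e y)%g ->
  (forall x, exists2 F, inc_lift F (e x) & exists y, F y = y) ->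
  closed S -> S !=set0 -> (forall x F, inc_lift F (e x) -> forall t, S t -> S (F t)) ->
  exists2 s, S s & forall x, e x (circle_exp s) = circle_exp s.
Proof.
move=> eD efix Scl [x0 Sx0] Sinv; have t0 := tau_gt0 R.
pose L F := exists2 x, inc_lift F (e x) & exists y, F y = y.
(* The two composites differ by some [tau * k]. At a fixed point [y] of [F] this is the displacement
   of [F' y] under [F], which is less than [tau], so [k = 0]. *)
have comm F F' : L F -> L F' -> forall t, F (F' t) = F' (F t).
  move=> [x Fx [y Fy]] [x' F'x' [y' _]].
  have FF' := inc_lift_comp Fx F'x'; have F'F := inc_lift_comp F'x' Fx.
  have xx' : e x' \o e x =1 e x \o e x'.
    by move=> z /=; rewrite -!DiffM -!eD addrC.
  have [k kE] := inc_lift_unique FF' (inc_lift_ext xx' F'F).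
  have := fixpoint_displacement (F' y) Fx Fy.
  have := kE y => /= ->; rewrite Fy addrC addKr normrM gtr0_norm// gtr_pMr//.
  rewrite -intr_norm -[1]/(1%:~R) ltr_int => k1 t.
  by have := kE t => /= ->; have -> : k = 0; [lia|rewrite mulr0 addr0].
(* Iterating [F] from a fixed point of [F'] stays among the fixed points of [F'] by commutation and
   inside a trap of [F]; the limit is fixed by both. *)
have L_comp F F' : L F -> L F' -> L (F \o F').
  move=> LF LF'; have [x Fx [y Fy]] := LF; have [x' F'x' [y' F'y']] := LF'.
  exists (x + x').
    by apply: inc_lift_ext (inc_lift_comp Fx F'x') => z /=; rewrite eD.
  have [z [zy' _ zF]] := fixpoint_trap Fx Fy y'.
  have itz n : z <= iter n F y' < z + tau by elim: n => //= n; exact: zF.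
  have [Fc _ _ _] := Fx; have [F'c _ _ _] := F'x'.
  have [||||l lE Fl] := @iter_cvg_fixpoint _ F [set u | F' u = u] y'
    (`|z| + tau) Fc (inc_lift_le Fx); last by exists l; rewrite /= lE Fl.
  - rewrite (_ : mkset _ = (fun u => F' u - u) @^-1` [set 0]).
      apply: preimage_closed; last exact: closed_eq.
      by move=> u _; apply: cvgB; [exact: F'c|exact: cvg_id].
    by apply/seteqP; split => u /= => [->|/subr0_eq//]; rewrite subrr.
  - by move=> u /= F'u; rewrite -comm// F'u.
  - exact: F'y'.
  move=> n; have /andP[a b] := itz n; have := ler_norm z; have := ler_norm (- z).
  by rewrite normrN ler_norml => ? ?; apply/andP; split; lra.
have L_inv F : L F -> exists2 F', L F' & cancel F' F.
  move=> [x Fx [y Fy]]; have [G [FG GF Gx]] := inc_lift_inv Fx.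
  exists G => //; exists (- x); last by exists y; rewrite -{1}Fy FG.
  apply: inc_lift_ext Gx => z; congr (diff_fun _ z).
  have e0 : e 0 = 1%g by apply: (mulgI (e 0)); rewrite -eD addr0 mulg1.
  by apply: (mulgI (e x)); rewrite mulgV -eD subrr e0.
pose O := [set t | exists2 F, L F & t = F x0].
have [F0 F0x F0f] := efix 0; have LF0 : L F0 by exists 0.
have O0 : O !=set0 by exists (F0 x0), F0.
have Oub : ubound O (x0 + tau).
  move=> _ [F [x Fx [y Fy]] ->]; have := fixpoint_displacement x0 Fx Fy.
  by rewrite ltr_norml => /andP[]; lra.
have Osup : has_sup O by split=> //; exists (x0 + tau).
(* If [F] moved the supremum up, it would also send nearby points of the orbit [O] above it,
   although [O] is stable under [F]. *)
have le_s F : L F -> F (sup O) <= sup O.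
  move=> LF; rewrite leNgt; apply/negP => sF.
  have [x [Fc F_lt _ _] _] := LF.
  have d0 : 0 < F (sup O) - sup O by rewrite subr_gt0.
  have [d dp dP] := (continuous_eps _ _).1 (Fc (sup O)) _ d0.
  have [o Oo so] := sup_adherent dp Osup.
  have os : o <= sup O by apply: ub_le_sup => //; exists (x0 + tau).
  have : F o <= sup O.
    apply: ub_le_sup; first by exists (x0 + tau).
    by case: Oo => F1 LF1 ->; exists (F \o F1) => //; exact: L_comp.
  have : `|o - sup O| < d by rewrite ltr_norml; apply/andP; split; lra.
  by move/dP; rewrite ltr_norml => /andP[]; lra.
exists (sup O).
  have OS : O `<=` S by move=> _ [F [x Fx _] ->]; exact: Sinv Fx _ Sx0.
  rewrite [S](closure_id _).1//.
  by apply: closureS OS _ _; apply: closure_sup => //; exists (x0 + tau).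
move=> x; have [F Fx Ff] := efix x; have LF : L F by exists x.
have [F' LF' F'K] := L_inv F LF.
have Fs : F (sup O) = sup O.
  apply/eqP; rewrite eq_le le_s//= -{1}(F'K (sup O)).
  by have [y Fy _] := LF; rewrite (inc_lift_le Fy)// le_s.
by have [_ _ _ <-] := Fx; rewrite Fs.
Qed.

End DiffLift.

(** * Generators of SL(2, R) *)

Section SL2Generators.
Variable R : realType.
Implicit Types a b c d x y t : R.

Definition mx2 a b c d : 'M[R]_2 :=
  \matrix_(i, j) (if i == 0 then if j == 0 then a else b else if j == 0 then c else d).

Lemma mx2_det a b c d : \det (mx2 a b c d) = a * d - b * c.
Proof. by rewrite det2E !mxE. Qed.

Lemma mx2_mul a b c d a' b' c' d' : mx2 a b c d *m mx2 a' b' c' d' =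
  mx2 (a * a' + b * c') (a * b' + b * d') (c * a' + d * c') (c * b' + d * d').
Proof.
apply/matrixP => i j; rewrite mul2E !mxE.
by case: ifP => _; case: ifP => _.
Qed.

Lemma mx2E (A : 'M[R]_2) : A = mx2 (A 0 0) (A 0 1) (A 1 0) (A 1 1).
Proof.
apply/matrixP => i j; rewrite mxE.
by case: i j => [[|[|//]] ?] [[|[|//]] ?]; rewrite -!val_eqE /=; congr (A _ _); exact/val_inj.
Qed.

Lemma mkSL2_subproof a b c d : a * d - b * c = 1 -> \det (mx2 a b c d) == 1.
Proof. by rewrite mx2_det => ->. Qed.

Definition mkSL2 a b c d (e : a * d - b * c = 1) : SL2 R := MkSL2 (mkSL2_subproof e).

Fact unip2_subproof x : 1 * 1 - x * 0 = 1 :> R. Proof. by ring. Qed.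
Definition unip2 x := mkSL2 (unip2_subproof x).

Fact diag2_subproof x : expR x * expR (- x) - 0 * 0 = 1 :> R.
Proof. by rewrite -expRD subrr expR0; ring. Qed.
Definition diag2 x := mkSL2 (diag2_subproof x).

Fact rot2_subproof t : cos t * cos t - sin t * - sin t = 1 :> R.
Proof. by rewrite mulrN opprK -!expr2 cos2Dsin2. Qed.
Definition rot2 t := mkSL2 (rot2_subproof t).

Fact weyl2_subproof : 0 * 0 - (-1) * 1 = 1 :> R. Proof. by ring. Qed.
Definition weyl2 := mkSL2 weyl2_subproof.

Lemma unip2D x y : unip2 (x + y) = (unip2 x * unip2 y)%g.
Proof. by apply: val_inj; rewrite /= mx2_mul; congr mx2; ring. Qed.

Lemma diag2D x y : diag2 (x + y) = (diag2 x * diag2 y)%g.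
Proof. by apply: val_inj; rewrite /= mx2_mul ?opprD ?expRD; congr mx2; ring. Qed.

Lemma rot2D x y : rot2 (x + y) = (rot2 x * rot2 y)%g.
Proof. by apply: val_inj; rewrite /= mx2_mul ?cosD ?sinD; congr mx2; ring. Qed.

Lemma diag2_unip2 x y : (diag2 x * unip2 y)%g = (unip2 (expR (x *+ 2) * y)%R * diag2 x)%g.
Proof.
have e1 : expR x * expR (- x) = 1 by rewrite -expRD subrr expR0.
apply: val_inj; rewrite /= !mx2_mul mulr2n expRD; congr mx2; [ring| |ring|ring].
transitivity (expR x * (expR x * expR (- x)) * y); last by ring.
by rewrite e1; ring.
Qed.

Lemma weyl2_diag2 x : (weyl2 * diag2 x)%g = (diag2 (- x)%R * weyl2)%g.
Proof. by apply: val_inj; rewrite /= !mx2_mul opprK; congr mx2; ring. Qed.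

Lemma weyl2_sq : val (weyl2 * weyl2)%g = - (1%:M : 'M[R]_2).
Proof.
rewrite /= mx2_mul [RHS]mx2E !mxE /=; congr mx2; ring.
Qed.

(** Exhibits [weyl2] as a square, so that its image preserves the orientation. *)
Lemma rot2_weyl2 : (rot2 (- (pi / 4))%R * rot2 (- (pi / 4))%R)%g = weyl2.
Proof.
rewrite -rot2D; apply: val_inj; rewrite /= -opprD.
have -> : pi / 4 + pi / 4 = pi / 2 :> R by field.
by rewrite cosN sinN cos_pihalf sin_pihalf opprK.
Qed.

(** The open cell of the Bruhat decomposition. A negative lower left entry costs a factor -1,
    written as the square of [weyl2]. *)
Lemma SL2_big_cell (A : SL2 R) : (A : 'M[R]_2) 1 0 != 0 -> exists B : SL2 R,
  [/\ A = (unip2 ((A : 'M[R]_2) 0 0 / (A : 'M[R]_2) 1 0)%R * weyl2 * B)%g &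
   exists x y, B = (diag2 x * unip2 y)%g \/ B = (weyl2 * weyl2 * (diag2 x * unip2 y))%g].
Proof.
have dA := eqP (SL2_det A); rewrite det2E in dA.
set a := (A : 'M[R]_2) 0 0 in dA *; set b := (A : 'M[R]_2) 0 1 in dA *.
set c := (A : 'M[R]_2) 1 0 in dA *; set d := (A : 'M[R]_2) 1 1 in dA *.
move=> c0; have bE : b = (a * d - 1) / c.
  by apply/(mulIf c0); rewrite divfK// -dA; ring.
have [cp|cn] := ltP 0 c.
  exists (diag2 (ln c) * unip2 (d / c)%R)%g; split; last by exists (ln c), (d / c); left.
  apply: val_inj; rewrite /= [LHS]mx2E -/a -/b -/c -/d !mx2_mul expRN lnK ?posrE// bE.
  by congr mx2; field.
have {}cn : 0 < - c by rewrite oppr_gt0 lt_neqAle c0.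
exists (weyl2 * weyl2 * (diag2 (ln (- c)) * unip2 (d / c)%R))%g; split; last first.
  by exists (ln (- c)), (d / c); right.
apply: val_inj; rewrite /= [LHS]mx2E -/a -/b -/c -/d !mx2_mul expRN lnK ?posrE// bE.
by congr mx2; field; rewrite ?oppr_eq0 c0.
Qed.

(** The open cell is a product of generators. A matrix outside it is brought inside by [weyl2],
    whose fourth power is 1. *)
Lemma SL2_gen (Q : SL2 R -> Prop) : (forall A B, Q A -> Q B -> Q (A * B)%g) ->
  (forall x, Q (unip2 x)) -> (forall x, Q (diag2 x)) -> Q weyl2 -> forall A, Q A.
Proof.
move=> QM Qu Qd Qw.
have big (A : SL2 R) : (A : 'M[R]_2) 1 0 != 0 -> Q A.
  move=> /SL2_big_cell[B [-> [x [y BE]]]]; apply: (QM _ _); first exact: QM.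
  by case: BE => ->; do ![exact: Qu|exact: Qd|exact: Qw|refine (QM _ _ _ _)].
move=> A; have [c0|] := eqVneq ((A : 'M[R]_2) 1 0) 0; last exact: big.
have -> : A = (weyl2 * weyl2 * (weyl2 * (weyl2 * A)))%g.
  apply: val_inj; rewrite /=; move: (SL2_mx A) => M.
  by rewrite (mx2E M) !mx2_mul; congr mx2; ring.
have dA := eqP (SL2_det A); rewrite det2E c0 mulr0 subr0 in dA.
have a0 : (A : 'M[R]_2) 0 0 != 0.
  by apply/eqP => a0; move: dA; rewrite a0 mul0r => /eqP; rewrite eq_sym oner_eq0.
apply: (QM _ _); [exact: QM|apply: (QM _ _) => //; apply: big].
by rewrite mul2E !mxE/= mul1r mul0r addr0.
Qed.

(** The angle doubles because the circle is identified with the space of lines of the plane; the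
    common denominator in [circle_act_crd] is constantly 2 for a rotation. *)
Lemma circle_act_rot2 x t : circle_act (rot2 x) (circle_exp t) = circle_exp (t + x *+ 2).
Proof.
have [_ X Y] := circle_act_crd (circle_exp t) (SL2_det_neq0 (rot2 x)).
have cs := cos2Dsin2 x.
have den : cos x * cos x * (1 + sin t) + (cos x * sin x + cos x * sin x) * cos t +
    sin x * sin x * (1 - sin t) + (- sin x * - sin x * (1 + sin t) +
    (- sin x * cos x + - sin x * cos x) * cos t + cos x * cos x * (1 - sin t)) = 2.
  rewrite -[RHS]mulr1 -cs; ring.
apply: S1_inj; rewrite ?X ?Y !mxE /= !crdy_exp !crdx_exp den.
  rewrite cosD cos_mulr2n sin_mulr2n -mulr_natr mulfK ?pnatr_eq0//.
  have -> : cos x ^+ 2 *+ 2 - 1 = cos x ^+ 2 - sin x ^+ 2 by rewrite -cs; ring.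
  by ring.
rewrite sinD cos_mulr2n sin_mulr2n.
have -> : cos x ^+ 2 *+ 2 - 1 = cos x ^+ 2 - sin x ^+ 2 by rewrite -cs; ring.
by field.
Qed.

Lemma moebius_unip2 x (t : option R) : moebius (unip2 x) t = omap (fun y => y + x) t.
Proof.
by case: t => [t|]; rewrite /moebius !mxE/= ?eqxx// mul0r add0r oner_eq0 mul1r divr1.
Qed.

Lemma moebius_diag2 x (t : option R) : moebius (diag2 x) t = omap (fun y => expR (x *+ 2) * y) t.
Proof.
case: t => [t|]; rewrite /moebius !mxE/= ?eqxx// mul0r add0r gt_eqF ?expR_gt0//.
by rewrite addr0 expRN invrK mulr2n expRD; congr Some; ring.
Qed.

Lemma moebius_weyl2 (t : option R) : moebius weyl2 t =
  if t is Some x then if x == 0 then None else Some (- x^-1) else Some 0.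
Proof.
case: t => [t|]; rewrite /moebius !mxE/=; last by rewrite oner_eq0 mul0r.
by rewrite mul1r addr0 mul0r add0r mulN1r.
Qed.

End SL2Generators.

(** * Topological rigidity *)

Section Rigidity.
Variables (R : realType) (p : regularity).
Local Notation tau := (tau R).
Local Notation S1 := (S1 R).
Variable rho : SL2 R -> Diff R p.
Hypothesis rhoM : forall A B, rho (A * B)%g = (rho A * rho B)%g.
Hypothesis rho_weyl2_sq : rho (weyl2 R * weyl2 R)%g = 1%g.
Hypothesis rho_nontrivial : exists A, rho A <> 1%g.

Let t0 : 0 < tau := tau_gt0 R.

Let rhoME A B z : rho (A * B)%g z = rho A (rho B z). Proof. by rewrite rhoM. Qed.

Let rho1 : rho 1%g = 1%g.
Proof. by apply: (mulgI (rho 1%g)); rewrite -rhoM !mulg1. Qed.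

Let rho_weyl2K z : rho (weyl2 R) (rho (weyl2 R) z) = z.
Proof. by rewrite -rhoME rho_weyl2_sq. Qed.

Let rho_unip2N x z : rho (unip2 x) (rho (unip2 (- x)) z) = z.
Proof.
rewrite -rhoME -unip2D subrr (_ : unip2 0 = 1%g) ?rho1//.
by apply: val_inj; rewrite /= [RHS]mx2E !mxE.
Qed.

Let rho_diag2N x z : rho (diag2 x) (rho (diag2 (- x)) z) = z.
Proof.
rewrite -rhoME -diag2D subrr (_ : diag2 0 = 1%g) ?rho1//.
by apply: val_inj; rewrite /= oppr0 expR0 [RHS]mx2E !mxE.
Qed.

(** Each generator is a square, and squares have increasing lifts. *)
Lemma rho_lift A : exists F, inc_lift F (rho A).
Proof.
apply: (SL2_gen (Q := fun A => exists F, inc_lift F (rho A))) => [B C [F HF] [G HG]|x|x|].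
- exists (F \o G); apply: inc_lift_ext (inc_lift_comp HF HG) => z /=.
  by rewrite rhoME.
- by have [F] := inc_lift_square (rho (unip2 (x / 2))); rewrite -rhoM -unip2D -splitr; exists F.
- by have [F] := inc_lift_square (rho (diag2 (x / 2))); rewrite -rhoM -diag2D -splitr; exists F.
- by have [F] := inc_lift_square (rho (rot2 (- (pi / 4)))); rewrite -rhoM rot2_weyl2; exists F.
Qed.

(** Conjugation by [diag2 (ln 2 / 2)] multiplies the parameter by 2, so [unip2 x] is conjugate to
    its square. *)
Let unip2_fixpoint x : exists2 F, inc_lift F (rho (unip2 x)) & exists y, F y = y.
Proof.
have [F HF] := rho_lift (unip2 x); have [K HK] := rho_lift (diag2 (ln 2 / 2)).
have [L [_ LK _]] := inc_lift_inv HK.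
apply: (conj_square_fixpoint HF HK); first by exists L.
move=> z /=; rewrite -!rhoME diag2_unip2 ?mulgA -unip2D; congr (diff_fun (rho (unip2 _ * _)%g) z).
by rewrite -(mulr_natr (ln 2 / 2)) divfK ?pnatr_eq0// lnK ?posrE ?ltr0n//; ring.
Qed.

(** [weyl2] conjugates [diag2 (x / 2)] to its inverse, and the fixed point is obtained for the
    square of that element. *)
Let diag2_fixpoint x : exists2 F, inc_lift F (rho (diag2 x)) & exists y, F y = y.
Proof.
have [B HB] := rho_lift (diag2 (x / 2)); have [K HK] := rho_lift (weyl2 R).
have [|F HF Ff] := conj_inverse_fixpoint HB HK.
  by move=> z /=; rewrite -[rho (weyl2 R) _]rhoME weyl2_diag2 rhoME rho_diag2N.
exists F => //; apply: inc_lift_ext HF => z /=.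
by rewrite -rhoME -diag2D -splitr.
Qed.

Let closed_fixed A : closed [set t | rho A (circle_exp t) = circle_exp t].
Proof.
have [/Creg_cont xc /Creg_cont yc] := diff_Cmap (rho A).
rewrite (_ : mkset _ =
    (fun t => crdx (rho A (circle_exp t)) - cos t) @^-1` [set 0] `&`
    (fun t => crdy (rho A (circle_exp t)) - sin t) @^-1` [set 0]).
  apply: closedI; apply: preimage_closed; try exact: closed_eq.
    by move=> t _; apply: cvgB; [exact: xc|exact: continuous_cos].
  by move=> t _; apply: cvgB; [exact: yc|exact: continuous_sin].
apply/seteqP; split => [t /= ->|t /= [/subr0_eq a /subr0_eq b]].
  by rewrite crdx_exp crdy_exp !subrr.
exact: S1_inj.
Qed.

(** The unipotent elements have a common fixed point. Their common fixed points form a closed set,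
    invariant under the diagonal elements, which normalize the unipotent subgroup; a second
    application inside this set fixes both. *)
Lemma borel_fixpoint : exists y, (forall x, rho (unip2 x) (circle_exp y) = circle_exp y) /\
  forall x, rho (diag2 x) (circle_exp y) = circle_exp y.
Proof.
have [|||y _ yu] := @common_fixpoint R p (fun x => rho (unip2 x)) setT _ unip2_fixpoint closedT.
- by move=> x y; rewrite unip2D rhoM.
- by exists 0.
- by [].
pose S := \bigcap_(x in @setT R) [set t | rho (unip2 x) (circle_exp t) = circle_exp t].
have [||||s Ss sd] := @common_fixpoint R p (fun x => rho (diag2 x)) S _ diag2_fixpoint.
- by move=> x x'; rewrite diag2D rhoM.
- by apply: closed_bigI => x _; exact: closed_fixed.
- by exists y => x _; exact: yu.
- move=> x F [_ _ _ FE] t St z _ /=; rewrite FE.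
  have -> : z = expR (x *+ 2) * (expR (- (x *+ 2)) * z).
    by rewrite mulrA -expRD subrr expR0 mul1r.
  by rewrite -rhoME -diag2_unip2 rhoME (St _ I).
by exists s; split=> // x; exact: (Ss x I).
Qed.

Let exp_inj y0 s t : y0 <= s < y0 + tau -> y0 <= t < y0 + tau ->
  circle_exp s = circle_exp t -> s = t.
Proof.
move=> /andP[s0 s1] /andP[t1 t2] /circle_exp_eq[k kE].
suff -> : s = t + tau * 0%:~R by rewrite mulr0 addr0.
rewrite kE; congr (_ + _ * _%:~R).
have : (-1 < k)%R by rewrite -(ltr_int R) -(ltr_pM2l t0) mulrNz mulrN1; lra.
have : (k < 1)%R by rewrite -(ltr_int R) -(ltr_pM2l t0) mulr1; lra.
by lia.
Qed.

Let lift_at A c d : rho A (circle_exp c) = circle_exp d ->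
  exists2 F, inc_lift F (rho A) & F c = d.
Proof.
move=> cd; have [F HF] := rho_lift A.
have [k kE] : exists k : int, F c = d + tau * k%:~R.
  by apply: circle_exp_eq; have [_ _ _ ->] := HF.
exists (fun t => F t + tau * (- k)%:~R); first exact: inc_lift_shift.
by rewrite kE mulrNz; ring.
Qed.

(** * The orbit of the point fixed by the Borel subgroup *)

Section Orbit.
Variable y0 : R.
Local Notation p0 := (circle_exp y0).
Local Notation q0 := (rho (weyl2 R) (circle_exp y0)).
Hypothesis unip2_p0 : forall x, rho (unip2 x) p0 = p0.
Hypothesis diag2_p0 : forall x, rho (diag2 x) p0 = p0.

(* A globally fixed point would make the involution rho weyl2 fix a point, so it
   would be trivial, and the normal closure of weyl2 is the whole group. *)
Let q0_neq : q0 <> p0.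
Proof.
move=> qp; have [W0 HW0] := rho_lift (weyl2 R).
have [k kE] : exists k : int, W0 y0 = y0 + tau * k%:~R.
  by apply: circle_exp_eq; case: HW0 => _ _ _ ->.
pose W t := W0 t + tau * (- k)%:~R.
have HW : inc_lift W (rho (weyl2 R)) := inc_lift_shift (- k) HW0.
have Wy : W y0 = y0 by rewrite /W kE mulrNz; ring.
have [m mE] : exists m : int, forall t, (W \o W) t = id t + tau * m%:~R.
  apply: (@inc_lift_unique _ _ _ id); last exact: inc_lift_id.
  by apply: inc_lift_ext (inc_lift_comp HW HW) => z /=; exact: rho_weyl2K.
have WW t : W (W t) = t.
  have := mE y0 => /=; rewrite !Wy => e; have := mE t => /= ->; move: e; lra.
have [Wc W_lt _ WE] := HW.
have Wid t : W t = t.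
  have [|tW|//] := ltgtP (W t) t; last first.
    by have := W_lt _ _ tW; rewrite WW => /(lt_trans tW); rewrite ltxx.
  by move=> tW; have := W_lt _ _ tW; rewrite WW => /lt_trans/(_ tW); rewrite ltxx.
have w1 z : rho (weyl2 R) z = z.
  by have [t <-] := circle_exp_surj z; rewrite -WE Wid.
have d1 x z : rho (diag2 x) z = z.
  rewrite [x]splitr diag2D rhoME -{2}(rho_diag2N (x / 2) z); congr (rho _ _).
  by rewrite -[RHS]w1 -[RHS]rhoME weyl2_diag2 opprK rhoME w1.
have u1 x z : rho (unip2 x) z = z.
  have c0 : expR 2 - 1 != 0 :> R.
    by rewrite subr_eq0 gt_eqF// expR_gt1 ltr0n.
  have e y v : rho (unip2 (expR (1 *+ 2) * y)) v = rho (unip2 y) v.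
    by rewrite -{1}(d1 1 v) -rhoME -diag2_unip2 rhoME d1.
  have -> : x = expR (1 *+ 2) * (x / (expR 2 - 1)) + - (x / (expR 2 - 1)) by field.
  by rewrite unip2D rhoME e rho_unip2N.
have [A []] := rho_nontrivial; apply: diff_ext => z; rewrite Diff1.
apply: (SL2_gen (Q := fun A => rho A z = z)) => // B C HB HC.
by rewrite rhoME HC HB.
Qed.

Let q_ex : exists2 q, y0 < q < y0 + tau & circle_exp q = q0.
Proof.
have [q qE] := circle_exp_surj q0.
have [k /andP[k0 k1]] := shift_in_period (q - y0) t0.
have E : circle_exp (q - tau * k%:~R) = q0 by rewrite -mulrN -mulrNz circle_exp_int.
exists (q - tau * k%:~R) => //; apply/andP; split; last by lra.
have : y0 <= q - tau * k%:~R by lra.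
rewrite le_eqVlt => /predU1P[e|//]; by case: q0_neq; rewrite -E -e.
Qed.

Let lift_y0_unique F G A : inc_lift F (rho A) -> inc_lift G (rho A) ->
  F y0 = y0 -> G y0 = y0 -> F =1 G.
Proof.
move=> HF HG Fy Gy t; have [k kE] := inc_lift_unique HF HG.
by have := kE y0; rewrite Fy Gy kE; lra.
Qed.

Let lift_y0_itv F A t : inc_lift F (rho A) -> F y0 = y0 ->
  y0 < t < y0 + tau -> y0 < F t < y0 + tau.
Proof.
by move=> [_ F_lt FP _] Fy /andP[a b]; rewrite -{1}Fy F_lt//= -{1}Fy -FP F_lt.
Qed.

Let diag2_q0 a : rho (diag2 a) q0 = q0.
Proof. by rewrite -{1}(opprK a) -rhoME -weyl2_diag2 rhoME diag2_p0. Qed.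

(** The product [weyl2 * unip2 x * weyl2] lies in the open cell with unipotent parameter [- x^-1],
    and its Borel factor fixes [p0]. *)
Let weyl2_unip2_q0 x : x != 0 -> rho (weyl2 R) (rho (unip2 x) q0) = rho (unip2 (- x^-1)) q0.
Proof.
move=> x0; pose A := (weyl2 R * unip2 x * weyl2 R)%g.
have AE : (A : 'M[R]_2) = mx2 (-1) 0 x (-1).
  by rewrite /A /= !mx2_mul; congr mx2; ring.
have A10 : (A : 'M[R]_2) 1 0 = x by rewrite AE mxE.
have A00 : (A : 'M[R]_2) 0 0 = -1 by rewrite AE mxE.
have [|B [ABE [a [b BE]]]] := @SL2_big_cell R A; first by rewrite A10.
have Bp : rho B p0 = p0.
  by case: BE => ->; rewrite !rhoME unip2_p0 diag2_p0 ?rho_weyl2K.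
have := congr1 (fun A => rho A p0) ABE.
by rewrite /= A10 A00 mulN1r /A !rhoME Bp.
Qed.

(* The sign s records whether the conjugacy preserves the orientation. *)
Lemma unipotent_orbit : exists2 K : R -> R,
  continuous K /\ {homo K : x y / x < y} &
  exists2 s : R, s * s = 1 & [/\ (forall x, y0 < K x < y0 + tau),
    (forall x, circle_exp (K x) = rho (unip2 (s * x)) q0) &
    (forall t, y0 < t < y0 + tau -> exists x, K x = t)].
Proof.
(* Lifts normalized to fix [y0] are unique, so relations of the group hold exactly for them, without
   multiples of [tau]. *)
have [U UP] : {U : R -> R -> R & forall x, inc_lift (U x) (rho (unip2 x)) /\ U x y0 = y0}.
  apply: (@choice _ _ (fun x F => inc_lift F (rho (unip2 x)) /\ F y0 = y0)) => x.
  by have [F ? ?] := lift_at (unip2_p0 x); exists F.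
have Ulift x : inc_lift (U x) (rho (unip2 x)) by have [] := UP x.
have Uy x : U x y0 = y0 by have [] := UP x.
have UD x y t : U (x + y) t = U x (U y t).
  have UU : inc_lift (U x \o U y) (rho (unip2 (x + y))) by rewrite unip2D rhoM; exact: inc_lift_comp.
  by apply: (lift_y0_unique (Ulift _) UU); rewrite /= !Uy.
have Uinj x : injective (U x) by exact: inc_lift_inj (Ulift x).
have U0 t : U 0 t = t by apply: (Uinj 0); rewrite -UD addr0.
have [q qI qE] := q_ex; have /andP[yq qy] := qI.
have [D DP] : {D : R -> R -> R & forall a, inc_lift (D a) (rho (diag2 a)) /\ D a y0 = y0}.
  apply: (@choice _ _ (fun a F => inc_lift F (rho (diag2 a)) /\ F y0 = y0)) => a.
  by have [F ? ?] := lift_at (diag2_p0 a); exists F.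
have Dlift a : inc_lift (D a) (rho (diag2 a)) by have [] := DP a.
have Dy a : D a y0 = y0 by have [] := DP a.
have in_itv t : y0 < t < y0 + tau -> y0 <= t < y0 + tau.
  by move=> /andP[/ltW-> ->].
have Dq a : D a q = q.
  apply: exp_inj; [exact/in_itv/(lift_y0_itv (Dlift a))|exact: in_itv|].
  by have [_ _ _ ->] := Dlift a; rewrite qE diag2_q0.
have DU a x t : D a (U x t) = U (expR (a *+ 2) * x) (D a t).
  have L1 : inc_lift (D a \o U x) (rho (diag2 a * unip2 x)%g) by rewrite rhoM; exact: inc_lift_comp.
  have L2 : inc_lift (U (expR (a *+ 2) * x) \o D a) (rho (diag2 a * unip2 x)%g).
    by rewrite diag2_unip2 rhoM; exact: inc_lift_comp.
  by apply: (lift_y0_unique L1 L2); rewrite /= ?Dy ?Uy ?Dy.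
(* If [unip2 x] fixed [q0], the relation with [weyl2] would give [unip2 (- x^-1) q0 = p0], hence
   [q0 = p0]. *)
have Uq x : x != 0 -> U x q <> q.
  move=> x0 xq; have xq0 : rho (unip2 x) q0 = q0.
    by rewrite -qE -{2}xq; have [_ _ _ ->] := Ulift x.
  apply: q0_neq; have := weyl2_unip2_q0 x0; rewrite xq0 rho_weyl2K => /(congr1 (rho (unip2 x^-1))).
  by rewrite rho_unip2N unip2_p0.
(* All positive parameters are conjugate under the diagonal lifts, which increase and fix [q]; so
   all [U x q] lie on the same side of [q]. *)
have Upos x : 0 < x -> exists a, U x q = D a (U 1 q).
  move=> x0; exists (ln x / 2).
  by rewrite DU Dq mulr1 -(mulr_natr (ln x / 2)) divfK ?pnatr_eq0// lnK.
have [s ss sU] : exists2 s : R, s * s = 1 & forall x, 0 < x -> q < U (s * x) q.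
  have [dn|up|] := ltgtP (U 1 q) q.
  - exists (-1) => [|x x0]; first by rewrite mulrNN mulr1.
    have [a aE] := Upos x x0; have [_ D_lt _ _] := Dlift a.
    have [_ U_lt _ _] := Ulift (- x).
    have : U x q < q by rewrite aE -[X in _ < X](Dq a) D_lt.
    by move/U_lt; rewrite -UD addrC subrr U0 mulN1r.
  - exists 1 => [|x x0]; first by rewrite mulr1.
    have [a aE] := Upos x x0; have [_ D_lt _ _] := Dlift a.
    by rewrite mul1r aE -[X in X < _](Dq a) D_lt.
  - by move/Uq; rewrite oner_eq0 => /(_ isT).
pose K x := U (s * x) q.
have KD x y : K (x + y) = U (s * x) (K y) by rewrite /K mulrDr UD.
have K0 : K 0 = q by rewrite /K mulr0 U0.
have K_lt : {homo K : x y / x < y}.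
  move=> x y xy; rewrite -(subrK x y) addrC KD /K.
  by have [_ U_lt _ _] := Ulift (s * x); apply: U_lt; apply: sU; rewrite subr_gt0.
(* The lifts [U] carry one continuity point of the monotone function [K] to every other point. *)
have Kc : continuous K.
  have [x0 cx0] := monotone_continuity_point (ltW_homo K_lt).
  move=> x; have -> : K = U (s * (x - x0)) \o (K \o (fun y => y + (x0 - x))).
    by apply/funext => y; rewrite /= -KD; congr K; ring.
  have [Uc _ _ _] := Ulift (s * (x - x0)).
  apply: continuous_comp; last exact: Uc.
  apply: (@continuous_comp _ _ _ (fun y => y + (x0 - x)) K).
    by apply: cvgD; [exact: cvg_id|exact: cvg_cst].
  by rewrite addrC subrK.
have KI x : y0 < K x < y0 + tau by exact: lift_y0_itv (Ulift _) (Uy _) qI.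
have KE x : circle_exp (K x) = rho (unip2 (s * x)) q0.
  by have [_ _ _ UE] := Ulift (s * x); rewrite /K UE qE.
exists K => //; exists s => //; split=> //.
(* [weyl2] maps a neighbourhood of [p0] into one of [q0], which the orbit covers by continuity of
   [K], and sends [unip2 x q0] back to [unip2 (- x^-1) q0]. So the orbit also covers the points
   close to [p0]. *)
have near_end c : circle_exp c = p0 -> exists2 d, 0 < d &
    forall t, y0 < t < y0 + tau -> `|t - c| < d -> exists x, K x = t.
  move=> cp; have [|W HW Wc] := @lift_at (weyl2 R) c q; first by rewrite cp qE.
  have [Wcont W_lt _ WE] := HW.
  have e0 : 0 < Num.min (q - K (-1)) (K 1 - q).
    by rewrite lt_min !subr_gt0 -K0 !K_lt ?ltrN10 ?ltr01.
  have [d d0 dP] := (continuous_eps _ _).1 (Wcont c) _ e0.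
  exists d => // t tI /dP; rewrite Wc lt_min !ltr_norml => /andP[/andP[A _] /andP[_ B]].
  have [|x xE] := @ivt _ K (-1) 1 (W t) Kc; first by apply/andP; split; lra.
  have x0 : x != 0.
    apply/eqP => x0; move: xE; rewrite x0 K0 -Wc => /esym/(inc_lift_inj HW) tc.
    have : t = y0.
      by apply: exp_inj; rewrite ?tc//; [rewrite -tc; exact: in_itv|rewrite lexx ltrDl].
    by move=> ty; move: tI; rewrite ty ltxx.
  exists (- x^-1); apply: exp_inj; [exact: in_itv|exact: in_itv|].
  have s0 : s != 0 by apply: contra_eq_neq ss => ->; rewrite mul0r eq_sym oner_neq0.
  have sV : s^-1 = s by rewrite -[RHS](mulfK s0) ss mul1r.
  by rewrite KE -[RHS]rho_weyl2K -(WE t) -xE KE weyl2_unip2_q0 ?mulf_neq0// invfM sV mulrN.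
have [d1 d10 d1P] := near_end y0 erefl.
have [|d2 d20 d2P] := near_end (y0 + tau).
  by have := circle_exp_int 1 y0; rewrite mulr1.
move=> t tI; have /andP[ty yt] := tI.
(* Halving the minimum gives a point strictly inside the interval, within [d1] of its end and below
   [t]; the other end is symmetric. *)
have [x1 x1E] : exists x, K x = y0 + Num.min d1 (t - y0) / 2.
  have m0 : 0 < Num.min d1 (t - y0) by rewrite lt_min d10 subr_gt0.
  have md : Num.min d1 (t - y0) <= d1 by rewrite ge_min lexx.
  have mt : Num.min d1 (t - y0) <= t - y0 by rewrite ge_min lexx orbT.
  apply: d1P; first by apply/andP; split; lra.
  by rewrite addrC addKr gtr0_norm; lra.
have [x2 x2E] : exists x, K x = y0 + tau - Num.min d2 (y0 + tau - t) / 2.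
  have m0 : 0 < Num.min d2 (y0 + tau - t) by rewrite lt_min d20 subr_gt0.
  have md : Num.min d2 (y0 + tau - t) <= d2 by rewrite ge_min lexx.
  have mt : Num.min d2 (y0 + tau - t) <= y0 + tau - t by rewrite ge_min lexx orbT.
  apply: d2P; first by apply/andP; split; lra.
  by rewrite addrC addKr normrN gtr0_norm; lra.
apply: (@ivt _ K x1 x2) => //; rewrite x1E x2E.
have mt : Num.min d1 (t - y0) <= t - y0 by rewrite ge_min lexx orbT.
have mt' : Num.min d2 (y0 + tau - t) <= y0 + tau - t by rewrite ge_min lexx orbT.
by apply/andP; split; lra.
Qed.

(** The equivariant map from RP^1: the Borel subgroup fixes infinity, and [x] is the image of
    infinity under [unip2 x * weyl2]. *)
Definition orbit_map (t : option R) : S1 :=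
  if t is Some x then rho (unip2 x) q0 else p0.

Lemma orbit_mapM (A : SL2 R) t : orbit_map (moebius A t) = rho A (orbit_map t).
Proof.
have um0 z : rho (unip2 0) z = z.
  by rewrite -[RHS](rho_unip2N 0 z) -rhoME -unip2D oppr0 addr0.
apply: (SL2_gen (Q := fun A => forall t, orbit_map (moebius A t) = rho A (orbit_map t))) =>
  {A t} [A B HA HB t|x t|x t|t].
- by rewrite moebiusM ?SL2_det_neq0// HA HB rhoME.
- by rewrite moebius_unip2; case: t => [y|] /=; rewrite ?unip2_p0// addrC unip2D rhoME.
- rewrite moebius_diag2; case: t => [y|] /=; rewrite ?diag2_p0//.
  by rewrite -[RHS]rhoME diag2_unip2 rhoME diag2_q0.
- rewrite moebius_weyl2; case: t => [y|] /=; last by rewrite um0.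
  have [->|yn0] := eqVneq y 0; first by rewrite um0 rho_weyl2K.
  by rewrite weyl2_unip2_q0.
Qed.

End Orbit.

(** Continuity at [t] of a curve in the circle, expressed by an angle so that lifts of circle maps
    can be composed with it. *)
Definition has_local_lift (G : R -> S1) (t : R) :=
  exists2 M : R -> R, {for t, continuous M} & \near t, circle_exp (M t) = G t.

Let local_lift_continuous G : (forall t, has_local_lift G t) ->
  continuous (fun t => crdx (G t)) /\ continuous (fun t => crdy (G t)).
Proof.
move=> GM; split=> t; have [M Mc MG] := GM t;
  rewrite /continuous_at -(nbhs_singleton MG).
  have C : cos (M x) @[x --> t] --> cos (M t).
    by apply: (@continuous_comp _ _ _ M (@cos R)) => //; exact: continuous_cos.
  by apply: cvg_trans C; apply: near_eq_cvg; apply: filterS MG => u <-.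
have C : sin (M x) @[x --> t] --> sin (M t).
  by apply: (@continuous_comp _ _ _ M (@sin R)) => //; exact: continuous_sin.
by apply: cvg_trans C; apply: near_eq_cvg; apply: filterS MG => u <-.
Qed.

Let local_lift_transport f F G u t : Cmap p f -> {for t, continuous u} ->
  has_local_lift G (u t) -> (forall t, F t = f (G (u t))) -> has_local_lift F t.
Proof.
move=> /Cmap_lift[L Lc LE] uc [M Mc MG] FE; exists (L \o (M \o u)).
  by apply: continuous_comp; [exact: continuous_comp|exact: Lc].
have Q : \near t, circle_exp (M (u t)) = G (u t) := uc _ MG.
by apply: filterS Q => v /=; rewrite FE LE => ->.
Qed.

(** The orbit map read through [stereo] is an equivariant bijection. It and its inverse are each
    continuous at one point, and equivariance under the rotations spreads continuity to the whole
    circle. *)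
Lemma topological_conjugacy : exists h g : S1 -> S1,
  [/\ cancel h g, cancel g h, Cmap (Cfin 0) h, Cmap (Cfin 0) g &
  forall (A : SL2 R) z, h (circle_act A z) = rho A (h z)].
Proof.
have [y0 [unip2_p0 diag2_p0]] := borel_fixpoint.
have [K [Kc K_lt] [s ss [KI KE Ksurj]]] := unipotent_orbit unip2_p0 diag2_p0.
have phiM := orbit_mapM unip2_p0 diag2_p0; set phi := orbit_map y0 in phiM.
have sK x : s * (s * x) = x by rewrite mulrA ss mul1r.
have phiE x : phi (Some x) = circle_exp (K (s * x)) by rewrite KE sK.
have KI' x : y0 <= K x < y0 + tau by have /andP[/ltW-> ->] := KI x.
have Kinj : injective K.
  by move=> x y xy; have [/K_lt|/K_lt|//] := ltgtP x y; rewrite xy ltxx.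
have phi_inj : injective phi.
  have noy x : circle_exp (K x) <> circle_exp y0.
    move=> /(exp_inj (KI' x)) H; have := KI x; rewrite H ?ltxx//.
    by rewrite lexx ltrDl.
  case=> [x|] [y|] //; rewrite ?phiE; [|by move/noy|by move/esym/noy].
  by move=> /(exp_inj (KI' _) (KI' _))/Kinj/(congr1 ( *%R s)); rewrite !sK => ->.
have phi_surj z : exists t, phi t = z.
  have [t <-] := circle_exp_surj z; have [k /andP[k0 k1]] := shift_in_period (t - y0) t0.
  rewrite -(circle_exp_int (- k)) mulrNz mulrN.
  have : y0 <= t - tau * k%:~R by lra.
  rewrite le_eqVlt => /predU1P[<-|yt]; first by exists None.
  have [|x xE] := Ksurj (t - tau * k%:~R); first by apply/andP; split; lra.
  by exists (Some (s * x)); rewrite phiE sK xE.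
have [phi' phi'K] := choice phi_surj.
have phiK : cancel phi phi' by move=> t; apply: phi_inj; rewrite phi'K.
pose h z := phi (stereo z); pose g z := stereo_inv (phi' z).
have hg : cancel h g by move=> z; rewrite /h /g phiK stereoK.
have gh : cancel g h by move=> z; rewrite /h /g stereo_invK phi'K.
have hM (A : SL2 R) z : h (circle_act A z) = rho A (h z).
  by rewrite /h /circle_act stereo_invK phiM.
have gM (A : SL2 R) z : g (rho A z) = circle_act A (g z).
  by rewrite -[RHS]hg hM gh.
(* The angle of the point with stereographic coordinate 0, around which [h] is given by [K]. *)
pose south : R := - (pi / 2).
have rot2_south t : circle_exp t = circle_act (rot2 ((t - south) / 2)) (circle_exp south).
  by rewrite circle_act_rot2; congr circle_exp; field.
have h_south : has_local_lift (fun t => h (circle_exp t)) south.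
  exists (fun t => K (s * (cos t / (1 - sin t)))).
    apply: (@continuous_comp _ _ _ (fun t => s * (cos t / (1 - sin t))) K); last exact: Kc.
    apply: cvgM; first exact: cvg_cst.
    apply: cvgM; first exact: continuous_cos.
    apply: cvgV; last by apply: cvgB; [exact: cvg_cst|exact: continuous_sin].
    by rewrite /south sinN sin_pihalf opprK gt_eqF// addr_gt0.
  have south1 : sin south < 1 by rewrite /south sinN sin_pihalf; lra.
  have N := cvgr_lt (sin south) (@continuous_sin R south) 1 south1.
  apply: filterS (N _) => t t1; rewrite /h /stereo crdy_exp crdx_exp lt_eqF//.
have h_lift t : has_local_lift (fun t => h (circle_exp t)) t.
  pose A := rot2 ((t - south) / 2).
  apply: (@local_lift_transport (rho A) _ (fun t => h (circle_exp t))
    (fun u => u - (t - south))) => [|||u].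
  - exact: diff_Cmap.
  - by apply: cvgB; [exact: cvg_id|exact: cvg_cst].
  - by rewrite opprB addrCA subrr addr0.
  - rewrite -hM circle_act_rot2; congr (h (circle_exp _)).
    by field.
have [Ki KiP] : {Ki : R -> R & forall t, y0 < t < y0 + tau -> K (Ki t) = t}.
  apply: (@choice _ _ (fun t x => y0 < t < y0 + tau -> K x = t)) => t.
  have [/Ksurj[x xE]|] := boolP (y0 < t < y0 + tau); [by exists x|by exists 0].
have KiK : cancel K Ki by move=> x; apply: Kinj; rewrite KiP.
have Kic : {for K 0, continuous Ki}.
  have : {near K 0, continuous Ki}.
    by apply: near_can_continuous; apply: filterE => x; [exact: KiK|exact: Kc].
  exact: nbhs_singleton.
have g_K0 : has_local_lift (fun t => g (circle_exp t)) (K 0).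
  pose G t := stereo_inv (Some (s * Ki t)).
  have uc : {for K 0, continuous (fun t => s * Ki t)}.
    by apply: cvgM; [exact: cvg_cst|exact: Kic].
  have vc : {for K 0, continuous (fun t => ((s * Ki t) ^+ 2 + 1)^-1)}.
    apply: cvgV; first exact: sqrD1_neq0.
    by apply: cvgD; [apply: cvgM; exact: uc|exact: cvg_cst].
  have [th0 th0E] := circle_exp_surj (G (K 0)).
  have [||th [_ thG thc _]] := @local_lift R G (K 0) th0 _ _ th0E.
  - by apply: cvgM; [apply: cvgD; exact: uc|exact: vc].
  - by apply: cvgM; [apply: cvgB; [apply: cvgM; exact: uc|exact: cvg_cst]|exact: vc].
  exists th => //; have /andP[K0 K1] := KI 0.
  have N1 := cvgr_gt (K 0) (cvg_id : x @[x --> K 0] --> K 0) y0 K0.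
  have N2 := cvgr_lt (K 0) (cvg_id : x @[x --> K 0] --> K 0) (y0 + tau) K1.
  apply: filterS3 thG (N1 _) (N2 _) => t -> a b; rewrite /G /g; congr stereo_inv.
  by apply: phi_inj; rewrite phi'K phiE sK KiP// a b.
have g_lift t : has_local_lift (fun t => g (circle_exp t)) t.
  have [a aE] := circle_exp_surj (g (circle_exp t)).
  pose th := (a - south) / 2.
  have K0 : circle_exp (K 0) = h (circle_exp south).
    rewrite /h /stereo crdy_exp crdx_exp /south sinN sin_pihalf cosN cos_pihalf mul0r.
    by rewrite lt_eqF ?(lt_trans (ltrN10 R) ltr01)// phiE mulr0.
  (* This rotation takes [g (circle_exp t)] to the south point, so the corresponding element of the
     image takes [circle_exp t] to [circle_exp (K 0)], where the local formula for [g] is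
     available. *)
  have [|F HF Ft] := @lift_at (rot2 (- th)) t (K 0).
    rewrite K0 -(gh (circle_exp t)) -aE (rot2_south a) -hM -circle_actM ?SL2_det_neq0//.
    by rewrite -[_ *m _]/(SL2_mx (rot2 _ * rot2 _)%g) -rot2D addNr circle_act_rot2 mul0rn addr0.
  have [Fc _ _ FE] := HF.
  apply: (@local_lift_transport (circle_act (rot2 th)) _ (fun t => g (circle_exp t)) F) => [|||u].
  - exact/Cmap_circle_act/SL2_det_neq0.
  - exact: Fc.
  - by rewrite Ft.
  - rewrite FE -gM -rhoME -rot2D subrr (_ : rot2 0 = 1%g) ?rho1//.
    by apply: val_inj; rewrite /= cos0 sin0 oppr0 [RHS]mx2E !mxE.
have [hx hy] := local_lift_continuous h_lift.
have [gx gy] := local_lift_continuous g_lift.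
by exists h, g; split=> //; split; exact/Ck0.
Qed.

End Rigidity.

(** * Conclusion *)

Section ConjugacyRegularity.
Variables (R : realType) (k : nat) (h g : S1 R -> S1 R).
Local Notation tau := (tau R).
Hypothesis hg : cancel h g.
Hypothesis gh : cancel g h.
Hypothesis hC : Cmap (Cfin 0) h.
Hypothesis gC : Cmap (Cfin 0) g.
Hypothesis rotC : forall t, Cmap (Cfin k.+2) (h \o circle_act (rot2 t) \o g).

(** With [F] a lift of [h], the lifts [F (G y + t)] of the conjugated rotations form a C^(k+2) flow,
    to which the regularity of conjugacies applies. *)
Lemma conjugacy_Cmap : Cmap (Cfin k.+2) h /\ Cmap (Cfin k.+2) g.
Proof.
have hD : is_Cdiffeo (Cfin 0) h by exists g.
have [F [G [Fc Gc FK GK [FE GE mono]]]] := diff_lift (MkDiff hD).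
have gE z : diff_inv (MkDiff hD) z = g z.
  by rewrite -[RHS](diff_invK (MkDiff hD)) /= gh.
have flowC t : Ck k.+2 (fun y => F (G y + t)).
  have E y : circle_exp (F (G y + t)) =
      (h \o circle_act (rot2 (t / 2)) \o g) (circle_exp y).
    by rewrite FE /= -gE -GE circle_act_rot2; congr (h (circle_exp _)); field.
  have [cC sC] := rotC (t / 2); apply: Ck_lift.
  - move=> y; apply: (@continuous_comp _ _ _ (fun y => G y + t) F); last exact: Fc.
    by apply: cvgD; [exact: Gc|exact: cvg_cst].
  - rewrite (_ : (fun y => _) = (fun y => crdx ((h \o circle_act (rot2 (t / 2)) \o g)
      (circle_exp y)))); first exact: cC.
    by apply/funext => y; rewrite -E.
  - rewrite (_ : (fun y => _) = (fun y => crdy ((h \o circle_act (rot2 (t / 2)) \o g)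
      (circle_exp y)))); first exact: sC.
    by apply/funext => y; rewrite -E.
have [FC GC] : Ck k.+2 F /\ Ck k.+2 G.
  case: mono => [[F_lt FP]|[F_lt FP]].
    exact: (conj_Ck (tau_gt0 R) Fc F_lt FP FK GK flowC).
  (* A decreasing lift is made increasing by precomposing with the reflection, which reverses the
     time of the flow. *)
  have oppC : Ck k.+2 (fun x : R => - x) := CkN (Ck_id R k.+2).
  have Foc : continuous (F \o -%R).
    by move=> x; apply: continuous_comp; [apply: cvgN; exact: cvg_id|exact: Fc].
  have FK' : cancel (F \o -%R) (-%R \o G) by move=> x; rewrite /= FK opprK.
  have GK' : cancel (-%R \o G) (F \o -%R) by move=> x; rewrite /= opprK GK.
  have [|A B] := conj_Ck (tau_gt0 R) Foc F_lt FP FK' GK' (k := k).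
    move=> t; rewrite (_ : (fun y => _) = (fun y => F (G y + - t))); first exact: flowC.
    by apply/funext => y; rewrite /= opprD opprK.
  split.
    rewrite (_ : F = (F \o -%R) \o -%R); first exact: (Ck_comp A oppC).
    by apply/funext => x; rewrite /= opprK.
  rewrite (_ : G = (fun x => - (-%R \o G) x)); first exact: CkN.
  by apply/funext => x; rewrite /= opprK.
have [sC cC] := Ck_trigo R k.+2; split; split.
- rewrite (_ : (fun t => _) = @cos R \o F); first exact: (Ck_comp cC FC).
  by apply/funext => t; rewrite /= -crdx_exp FE.
- rewrite (_ : (fun t => _) = @sin R \o F); first exact: (Ck_comp sC FC).
  by apply/funext => t; rewrite /= -crdy_exp FE.
- rewrite (_ : (fun t => _) = @cos R \o G); first exact: (Ck_comp cC GC).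
  by apply/funext => t; rewrite /= -crdx_exp GE gE.
- rewrite (_ : (fun t => _) = @sin R \o G); first exact: (Ck_comp sC GC).
  by apply/funext => t; rewrite /= -crdy_exp GE gE.
Qed.

End ConjugacyRegularity.

Lemma Cmap_Cinf (R : realType) (f : S1 R -> S1 R) :
  Cmap Cinf f <-> forall k, Cmap (Cfin k.+2) f.
Proof.
split=> [[fx fy] k|fk]; first by split; [exact: fx|exact: fy].
have k2 k : (k <= k.+2)%N by rewrite ltnW.
by split=> k; have [fx fy] := fk k; [exact: CkW_le (k2 k) fx|exact: CkW_le (k2 k) fy].
Qed.

Theorem theorem4 (R : realType) (p : regularity) (hp : p <> Cfin 1)
    (Phi : {multiplicative PSL2 R -> Diff R p})
    (hPhi : exists g : PSL2 R, Phi g <> 1%g) :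
  exists h : Diff R p, forall g : PSL2 R,
    Phi g = (h * std_incl p g * h^-1)%g.
Proof.
(* Working on SL(2, R) gives access to matrices; factoring through the quotient survives as the
   triviality of [rho] on -1, the square of [weyl2]. *)
pose rho (A : SL2 R) := Phi (\pi_(PSL2 R) A)%qT.
have rhoM A B : rho (A * B)%g = (rho A * rho B)%g by rewrite /rho -PSL2M gmulfM.
have rho_weyl2 : rho (weyl2 R * weyl2 R)%g = 1%g.
  have /PSL2_eqP pm : SL2_pm (weyl2 R * weyl2 R)%g 1%g.
    by apply/orP; right; apply/eqP; exact: weyl2_sq.
  by apply: (mulgI (rho (weyl2 R * weyl2 R)%g)); rewrite mulg1 /rho pm -gmulfM mulg1.
have rho_nontrivial : exists A, rho A <> 1%g.
  by have [a] := hPhi; elim/PSL2_ind: a => A; exists A.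
have [h [g [hg gh hC gC hM]]] := topological_conjugacy rhoM rho_weyl2 rho_nontrivial.
have rotE t : h \o circle_act (rot2 t) \o g = rho (rot2 t).
  by apply/funext => z; rewrite -[LHS]/(h (circle_act (rot2 t) (g z))) hM gh.
have hgC : Cmap p h /\ Cmap p g.
  have rotC t : Cmap p (h \o circle_act (rot2 t) \o g) by rewrite rotE; exact: diff_Cmap.
  (* Class 0 is the topological statement and class 1 is excluded; the infinite class is treated
     through all finite classes from 2 on. *)
  move: rotC; case: (p) hp => [[|[|k]]|] // _ rotC; first exact: (conjugacy_Cmap hg gh hC gC).
  have hgk k : Cmap (Cfin k.+2) h /\ Cmap (Cfin k.+2) g.
    by apply: (conjugacy_Cmap hg gh hC gC) => t; exact: (Cmap_Cinf _).1 (rotC t) k.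
  by split; apply: (Cmap_Cinf _).2 => k; have [] := hgk k.
have hD : is_Cdiffeo p h by case: hgC => ? ?; exists g.
exists (MkDiff hD); elim/PSL2_ind => A; apply: diff_ext => z.
rewrite !DiffM std_incl_pi /= hM; congr (diff_fun (rho A) _).
by rewrite -[LHS](diff_invKr (MkDiff hD)).
Qed.
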